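(* Let $(X,d)$ be a compact metric space whose topological (covering) dimension is bigger than one, and let $\phi$ be a regular expansive continuous flow on $X$. Then $X$ contains infinitely many minimal subsets for $\phi$.
   Context: A continuous flow on $X$ is a continuous map $\phi\colon\mathbb{R}\times X\to X$, $\phi_t=\phi(t,\cdot)$, with $\phi_0=\mathrm{id}$ and $\phi_{t+s}=\phi_s\circ\phi_t$. It is regular if it has no fixed points (no $x$ with $\phi_t(x)=x$ for all $t$). A minimal subset is a nonempty compact set $K$ with $\phi_t(K)=K$ for all $t$ containing no nonempty proper compact invariant subset. Let $Rep$ be the set of increasing homeomorphisms $h\colon\mathbb{R}\to\mathbb{R}$ with $h(0)=0$. The flow $\phi$ is expansive if for every $\varepsilon>0$ there is $\delta>0$ such that whenever $x,y\in X$ and $h\in Rep$ satisfy $d(\phi_t(x),\phi_{h(t)}(y))\le\delta$ for all $t\in\mathbb{R}$, then $y\in\phi_{[-\varepsilon,\varepsilon]}(x)$. *)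

(* Defs.v *)
From HB Require Import structures.
From mathcomp Require Import all_boot all_order all_algebra.
From mathcomp Require Import all_classical all_reals all_analysis.
Set Implicit Arguments. Unset Strict Implicit. Unset Printing Implicit Defensive.
Import Order.TTheory GRing.Theory Num.Theory.
Import numFieldNormedType.Exports.
Local Open Scope classical_set_scope.
Local Open Scope ring_scope.

Section Defs.
Context {R : realType} {X : metricType R}.

Definition covering_dim_le (T : topologicalType) (n : nat) : Prop :=
  forall (k : nat) (U : 'I_k -> set T),
    (forall i, open (U i)) -> \bigcup_i U i = [set: T] ->
    exists (m : nat) (V : 'I_m -> set T),
      [/\ (forall j, open (V j)),
          \bigcup_j V j = [set: T],
          (forall j, exists i, V j `<=` U i) &
          (forall s : 'I_(n.+2) -> 'I_m, injective s ->
             \bigcap_i V (s i) = set0)].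

Definition is_flow (phi : R -> X -> X) : Prop :=
  [/\ continuous (fun p : R * X => phi p.1 p.2),
      (forall x, phi 0 x = x) &
      (forall t s x, phi (t + s) x = phi s (phi t x))].

Definition regular_flow (phi : R -> X -> X) : Prop :=
  forall x, ~ (forall t, phi t x = x).

Definition invariant_set (phi : R -> X -> X) (K : set X) : Prop :=
  forall t, phi t @` K = K.

Definition minimal_set (phi : R -> X -> X) (K : set X) : Prop :=
  [/\ K !=set0, compact K, invariant_set phi K &
      forall L, L `<=` K -> L !=set0 -> compact L -> invariant_set phi L ->
        L = K].

Definition Rep (h : R -> R) : Prop :=
  [/\ h 0 = 0, {homo h : a b / a < b}, continuous h &
      exists g : R -> R, [/\ cancel h g, cancel g h & continuous g]].

Definition expansive_flow (phi : R -> X -> X) : Prop :=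
  forall eps : R, 0 < eps -> exists2 delta : R, 0 < delta &
    forall (x y : X) (h : R -> R), Rep h ->
      (forall t, mdist (phi t x) (phi (h t) y) <= delta) ->
      exists2 s : R, - eps <= s <= eps & y = phi s x.

End Defs.

(* Main.v *)
Require Import Defs.
From HB Require Import structures.
From mathcomp Require Import all_boot all_order all_algebra.
From mathcomp Require Import all_classical all_reals all_analysis.
From mathcomp Require Import lra.
Import Order.TTheory GRing.Theory Num.Theory.
Import numFieldNormedType.Exports.
Set Implicit Arguments. Unset Strict Implicit. Unset Printing Implicit Defensive.
Local Open Scope classical_set_scope.
Local Open Scope ring_scope.

(** Suppose there are only finitely many minimal sets, and choose a point in each
of them; then every orbit accumulates on one of these points. By compactness and
the absence of fixed points there is a function [V q] that grows at a uniform rate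
along the orbits near [q], so that its level sets are local cross-sections. If one
of them contained a nontrivial continuum, expansivity would force a small piece of
it to grow, in the past or in the future, under the flow synchronized along
sections. As in Mane's argument, a continuum which has been small for a long time
and has just grown contains two disjoint continua with the same property; after
[k] generations there are [2 ^ k] of them, while the number of visits of a past
orbit segment to tiny balls around the chosen points is only linear in [k]. Hence
one can keep growing while avoiding these balls, and in the limit an orbit avoids
them forever, a contradiction. So all cross-sections are totally disconnected, every
point has small flow boxes with zero-dimensional boundary, and the covering
dimension is at most one. *)

(** * Compactness *)

Section Compactness.
Context {T : topologicalType}.
Implicit Types (K C : set T) (D : set (set T)).

(** Since expansivity allows a time change, orbits are compared only at successive section hits, on
    two independent clocks with steps between [eta / 2] and [2 * eta]. Endless tracking in both
    directions of time yields a reparametrization, and the resulting [y = phi s x] improves to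
    [y = x] because both points lie on one level of [V q]. Compactness then gives one number [N] of
    steps within which every continuum of size at least [eps / 4] with a small past must grow; this
    uniformity is what makes [k] generations last a time linear in [k]. The small past is carried
    along as part of the state, since expansivity alone does not tell in which direction of time two
    points separate. The balls to be avoided are seen from the section: the visits to one ball
    during one short time window come from a set of small diameter, which cannot reach two separated
    daughters at once. *)

Lemma compact_directed K D :
  compact K -> D !=set0 ->
  (forall A B, D A -> D B -> exists2 C, D C & C `<=` A `&` B) ->
  (forall A, D A -> closed A /\ K `&` A !=set0) ->
  exists2 x, K x & forall A, D A -> A x.
Proof.
move=> cK D0 Ddir Dcl; pose F := filter_from D (fun A => K `&` A).
have PF : ProperFilter F.
  apply: filter_from_proper; last by move=> A /Dcl[].
  apply: filter_from_filter => // A B DA DB.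
  by have [C DC CAB] := Ddir _ _ DA DB; exists C => // x [Kx /CAB[]].
have [x [Kx Fx]] : K `&` cluster F !=set0.
  by apply: cK; case: D0 => A DA; exists A => // x [].
exists x => // A DA; have [clA _] := Dcl _ DA; apply: clA.
rewrite closureEcluster => B C AB; apply: Fx.
by exists A => // y [_ Ay]; exact: AB.
Qed.

(** Source of most uniform bounds below: if a bound fails for every [n], the counterexamples form
    nested closed sets, and a common point violates the limit statement. *)
Lemma compact_nested K (F : nat -> set T) :
  compact K -> (forall n, closed (F n)) ->
  (forall n, F n.+1 `<=` F n) -> (forall n, K `&` F n !=set0) ->
  exists2 x, K x & forall n, F n x.
Proof.
move=> cK clF decF F0.
have mono m n : (m <= n)%N -> F n `<=` F m.
  move=> /subnK <-; elim: (n - m)%N => [|k IH] //.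
  by rewrite addSn => x /decF /IH.
have [||A [n _ <-]|x Kx Fx] := compact_directed (D := range F) cK.
- by exists (F 0); exists 0.
- move=> _ _ [m _ <-] [n _ <-]; exists (F (maxn m n)); first by exists (maxn m n).
  by move=> x Fx; split; apply: mono Fx; rewrite (leq_maxl, leq_maxr).
- by split => //; exact: F0.
by exists x => // n; apply: Fx; exists n.
Qed.

Lemma compact_finite_subcover K (O : T -> set T) :
  compact K -> (forall x, K x -> open (O x) /\ O x x) ->
  exists2 s : seq T, (forall x, x \in s -> K x) &
    K `<=` [set y | exists2 x, x \in s & O x y].
Proof.
move=> cK Oo; apply: contrapT => H.
pose G (s : seq T) := ~` [set y | exists2 x, x \in s & O x y].
pose D := [set G s | s in [set s | forall x, x \in s -> K x]].
have [||A [s sK <-]|x Kx Dx] := compact_directed (D := D) cK.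
- by exists (G [::]); exists [::].
- move=> _ _ [s sK <-] [t tK <-]; exists (G (s ++ t)).
    by exists (s ++ t) => // x; rewrite mem_cat => /orP[/sK|/tK].
  by move=> y nst; split => -[x xs Oxy]; apply: nst; exists x => //;
     rewrite mem_cat xs ?orbT.
- split.
    apply: open_closedC; rewrite (_ : mkset _ = \bigcup_(x in [set` s]) O x).
      by apply: bigcup_open => x /= /sK /Oo[].
    by apply/seteqP; split => y [x xs Oxy]; exists x.
  apply: contrapT => E; apply: H; exists s => // y Ky.
  by apply: contrapT => nOy; apply: E; exists y.
have /Dx[] : D (G [:: x]) by exists [:: x] => // y /=; rewrite inE => /eqP ->.
by exists x; [rewrite inE|case: (Oo _ Kx)].
Qed.

End Compactness.

Lemma closed_projection (A B : topologicalType) (K : set A) (C : set (A * B)) :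
  compact K -> closed C -> closed [set b | exists2 a, K a & C (a, b)].
Proof.
move=> /compact_near_coveringP cK clC.
rewrite (_ : mkset _ = ~` [set b | K `<=` [set a | ~ C (a, b)]]); last first.
  apply/seteqP; split => b /=.
    by move=> [a Ka Cab] /(_ _ Ka); apply.
  by move=> H; apply: contrapT => H2; apply: H => a Ka Cab; apply: H2; exists a.
apply: open_closedC; rewrite openE => b Kb /=.
apply: (cK B (nbhs b) (fun b a => ~ C (a, b))) => a Ka.
have oC : nbhs (a, b) (~` C).
  by apply: open_nbhs_nbhs; split; [exact: closed_openC|exact: Kb].
by case: oC => -[U V] UV sUV; exists (U, V) => // -[x y] /sUV.
Qed.

(** * Metric neighbourhoods and closed conditions *)

Section Metric.
Context {R : realType} {X : metricType R}.
Implicit Types (x y : X) (A B C L P U : set X).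

Lemma mdist_nbhsP x A :
  nbhs x A <-> exists2 e : R, 0 < e & forall y, mdist x y < e -> A y.
Proof.
by rewrite -metricType_numDomainType.filter_from_mdist_nbhs; split => -[e e0 h];
   exists e.
Qed.

Lemma mdist_continuous : continuous (fun z : X * X => mdist z.1 z.2 : R).
Proof.
move=> [x y]; apply/cvgrPdist_lt => e e0 /=.
have e20 : 0 < e / 2 by rewrite divr_gt0.
exists ([set x' | mdist x x' < e / 2], [set y' | mdist y y' < e / 2]).
  by split; apply/mdist_nbhsP; exists (e / 2).
move=> [x' y'] /= [h1 h2]; rewrite ltr_norml.
have := metric_triangle x x' y; have := metric_triangle x' y' y.
have := metric_triangle x' x y'; have := metric_triangle x y y'.
rewrite (metric_sym y' y) (metric_sym x' x) => ? ? ? ?; apply/andP; split; lra.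
Qed.

Lemma continuous_mdist {T : topologicalType} (f g : T -> X) :
  continuous f -> continuous g -> continuous (fun t => mdist (f t) (g t) : R).
Proof.
move=> cf cg t.
apply: (@continuous_comp _ _ _ (fun t => (f t, g t))
  (fun z : X * X => mdist z.1 z.2 : R)); last exact: mdist_continuous.
by apply: cvg_pair; [exact: cf|exact: cg].
Qed.

Lemma closed_le_fun {T : topologicalType} (f g : T -> R) :
  continuous f -> continuous g -> closed [set t | f t <= g t].
Proof.
move=> cf cg.
rewrite (_ : mkset _ = (fun t => g t - f t) @^-1` [set x | 0 <= x]).
  apply: closed_comp; last exact: closed_ge.
  by move=> t _; apply: cvgB; [exact: cg|exact: cf].
by apply/seteqP; split => t /=; rewrite subr_ge0.
Qed.

Lemma closed_mdist_le x r : closed [set y | mdist x y <= r].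
Proof.
apply: closed_le_fun; last exact: cst_continuous.
by apply: continuous_mdist; [exact: cst_continuous|move=> ?; exact: cvg_id].
Qed.

Lemma closed_mdist_ge x r : closed [set y | r <= mdist x y].
Proof.
apply: closed_le_fun; first exact: cst_continuous.
by apply: continuous_mdist; [exact: cst_continuous|move=> ?; exact: cvg_id].
Qed.

Lemma open_mdist_lt x r : open [set y | mdist x y < r].
Proof.
rewrite (_ : mkset _ = ~` [set y | r <= mdist x y]).
  exact/closed_openC/closed_mdist_ge.
by apply/seteqP; split => y /=; rewrite ltNge => /negP.
Qed.

Lemma compactT_closed : compact [set: X] -> forall A, closed A -> compact A.
Proof. by move=> cX A clA; apply: (subclosed_compact clA cX). Qed.

Lemma compactX_closed A : compact A -> closed A.
Proof. by apply: compact_closed; exact: metric_hausdorff. Qed.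

End Metric.

(** * Continua and zero-dimensional sets *)

Section CompactMetric.
Context {R : realType} {X : metricType R} (cX : compact [set: X]).
Implicit Types (x y : X) (A B C L N P U : set X).

Lemma compact_shrink A U : closed A -> open U -> A `<=` U ->
  exists N, [/\ open N, A `<=` N & closure N `<=` U].
Proof.
move=> clA oU AU.
have /(_ U)[|V /set_nbhsP[N [oN AN NV]] VU] :=
  compact_normal (@metric_hausdorff _ X) cX clA.
  by apply/set_nbhsP; exists U; split => // x.
by exists N; split => //; apply: subset_trans VU; exact: closureS.
Qed.

Lemma disjoint_open_nbhs A B : closed A -> closed B -> A `&` B = set0 ->
  exists U V, [/\ open U, open V, A `<=` U, B `<=` V & U `&` V = set0].
Proof.
move=> clA clB AB; have [|N [oN AN NB]] := compact_shrink clA (closed_openC clB).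
  by move=> x Ax Bx; have : (A `&` B) x by []; rewrite AB.
exists N, (~` closure N); split => //.
- exact/closed_openC/closed_closure.
- by move=> x Bx /NB.
- by apply/seteqP; split => // x [/subset_closure].
Qed.

(** In a compact set, components are quasicomponents. If no relatively clopen [P] fits into [U],
    compactness puts a point outside [U] into the intersection [Q] of all clopen sets around [x];
    but [Q] is connected, so it lies in the component. *)
Lemma component_clopen L U x : closed L -> open U -> L x ->
  connected_component L x `<=` U ->
  exists P, [/\ P `<=` L `&` U, P x, closed P & closed (L `\` P)].
Proof.
move=> clL oU Lx LU; apply: contrapT => noP.
pose D := [set P | [/\ P `<=` L, P x, closed P & closed (L `\` P)]].
have D0 : D !=set0 by exists L; split => //; rewrite setDv; exact: closed0.
have Ddir A B : D A -> D B -> exists2 C, D C & C `<=` A `&` B.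
  move=> [AL Ax cA cLA] [BL Bx cB cLB]; exists (A `&` B) => //; split => //.
  - by move=> z [/AL].
  - exact: closedI.
  - by rewrite setDIr; exact: closedU.
have meetD K : closed K -> (forall P, D P -> K `&` P !=set0) ->
    exists2 y, K y & forall P, D P -> P y.
  move=> clK KP; apply: compact_directed => //.
    exact: (subclosed_compact clK cX).
  by move=> P DP; split; [case: DP|exact: KP].
have [|y nUy Dy] := meetD (~` U) (open_closedC oU).
  move=> P [PL Px cP cLP]; apply: contrapT => E; apply: noP; exists P; split => //.
  by move=> z Pz; split; [exact: PL|apply: contrapT => nUz; apply: E; exists z].
pose Q := [set z | forall P, D P -> P z].
have clQ : closed Q.
  rewrite (_ : Q = \bigcap_(P in D) P); last by [].
  by apply: closed_bigI => P [].
have QL : Q `<=` L by move=> z; apply; split => //; rewrite setDv; exact: closed0.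
have Qx : Q x by move=> P [].
suff cQ : connected Q by apply: nUy; apply: LU; apply: (connected_component_max Qx).
apply: contrapT => /connectedPn[E [E0 QE [sE1 sE2]]].
have clE b : closed (E b).
  rewrite /closed => z clz.
  have Qz : Q z.
    by apply: clQ; apply: closureS clz => w Ew; rewrite QE; case: b Ew; [right|left].
  move: Qz; rewrite {1}QE; case: b clz => clz [Ez|Ez] //.
    by have : (E false `&` closure (E true)) z by []; rewrite sE2.
  by have : (closure (E false) `&` E true) z by []; rewrite sE1.
have Edisj b z : E b z -> E (~~ b) z -> False.
  move=> Eb Enb; have : (closure (E false) `&` E true) z.
    by case: b Eb Enb => /= Eb Enb; split => //; exact: subset_closure.
  by rewrite sE1.
have QEb b : Q = E b `|` E (~~ b) by case: b; rewrite //= setUC.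
have [b Ebx] : exists b, E b x.
  by move: Qx; rewrite QE => -[]; [exists false|exists true].
have [N [oN EN NE]] :
    exists N, [/\ open N, E b `<=` N & closure N `<=` ~` E (~~ b)].
  by apply: compact_shrink => // [|z /Edisj]; [exact: closed_openC|].
(* By compactness some clopen [P] already misses the boundary of [N]. Then [P] cut by [N] is clopen
   too, and it loses the other half of the separation of [Q]. *)
have [P DP PN] : exists2 P, D P & P `<=` N `|` ~` closure N.
  apply: contrapT => noP'.
  have [||z [nNz clNz] Dz] := meetD (~` N `&` closure N).
  - by apply: closedI; [exact: open_closedC|exact: closed_closure].
  - move=> P DP; apply: contrapT => E'; apply: noP'; exists P => // z Pz.
    by apply: contrapT => /not_orP[h1 /contrapT h2]; apply: E'; exists z.
  by have : Q z by []; rewrite (QEb b) => -[/EN//|]; exact: NE.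
have [w Ew] := E0 (~~ b).
have : D (P `&` N).
  case: DP => PL Px cP cLP; split => //.
  - by move=> z [/PL].
  - by split => //; exact: EN.
  - rewrite (_ : _ `&` _ = P `&` closure N).
      by apply: closedI => //; exact: closed_closure.
    apply/seteqP; split => z [Pz Nz]; split => //; first exact: subset_closure.
    by case: (PN _ Pz).
  - rewrite setDIr; apply: closedU => //.
    by apply: closedI => //; exact: open_closedC.
have : Q w by rewrite (QEb b); right.
by move=> /[apply] -[_ Nw]; apply: (NE w) Ew; exact: subset_closure.
Qed.

(** [D] is the component of [a] in the part of [C] within distance [r]. If it stayed away from the
    sphere, [component_clopen] would give a clopen part of the open ball, clopen in all of [C] and
    missing [b]. *)
Lemma boundary_bumping C a b r : closed C -> connected C -> C a -> C b ->
  0 < r -> r <= mdist a b ->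
  exists D, [/\ closed D, connected D, D a,
    D `<=` C `&` [set y | mdist a y <= r] & exists2 y, D y & r <= mdist a y].
Proof.
move=> clC cC Ca Cb r0 rab.
pose L := C `&` [set y | mdist a y <= r].
have clL : closed L by apply: closedI => //; exact: closed_mdist_le.
have La : L a by split => //=; rewrite mdistxx ltW.
exists (connected_component L a); split.
- exact: component_closed.
- exact: component_connected.
- exact: connected_component_refl.
- exact: connected_component_sub.
apply: contrapT => noy.
have [|P [PLU Pa clP clLP]] := component_clopen clL (@open_mdist_lt _ _ a r) La.
  by move=> y Dy /=; rewrite ltNge; apply/negP => ry; apply: noy; exists y.
have PC : P `<=` C by move=> z /PLU[[]].
have : P = C.
  apply: cC; first by exists a.
    exists (~` ((L `\` P) `|` [set y | r <= mdist a y])).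
      by apply: closed_openC; apply: closedU => //; exact: closed_mdist_ge.
    apply/seteqP; split => z.
      move=> /[dup] /PLU[[Cz _] /= zr] Pz; split => // -[[]//|/=].
      by rewrite leNgt zr.
    move=> [Cz /not_orP[h1 h2]]; apply: contrapT => nPz; apply: h1; split => //.
    by split => //=; rewrite leNgt; apply/negP => /ltW.
  by exists P => //; apply/seteqP; split => [z Pz|z []//]; split => //; exact: PC.
by move=> PE; have := Cb; rewrite -PE => /PLU[_ /=]; rewrite ltNge rab.
Qed.

(** The sets are open and disjoint in the whole space, not just on [L], so that they can serve
    directly as members of a cover of [X]. The predicate [small] stands for refinement of a given
    cover. *)
Definition disjoint_small_cover (small : set X -> Prop) L :=
  exists (I : finType) (V : I -> set X),
    [/\ forall i, open (V i) /\ small (V i),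
        forall i j, i != j -> V i `&` V j = set0 &
        L `<=` \bigcup_i V i].

Definition zero_dim_in L := forall small : set X -> Prop,
  (forall A B, A `<=` B -> small B -> small A) ->
  (forall x, exists2 O, open O /\ small O & O x) ->
  disjoint_small_cover small L.

(** Components are points, so each point has a relatively clopen neighbourhood inside a small open
    set. Finitely many suffice; they are peeled off one at a time, normality separating each piece
    from the rest in the ambient space. *)
Lemma totally_disconnected_zero_dim L :
  closed L -> totally_disconnected L -> zero_dim_in L.
Proof.
move=> clL tdL small smallS smallx.
have exG x : exists G, L x -> [/\ open G, small G, G x & closed (L `&` G)].
  have [Lx|nLx] := pselect (L x); last by exists set0.
  have [G0 [oO sO] Ox] := smallx x.
  have [|P [PLO Px clP clLP]] := component_clopen clL oO Lx.
    by rewrite tdL // => _ ->.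
  exists (G0 `&` ~` (L `\` P)) => _; split.
  - by apply: openI => //; exact: closed_openC.
  - by apply: smallS sO => z [].
  - by split => // -[_]; apply.
  - rewrite (_ : _ `&` _ = P) //; apply/seteqP; split => z.
      by move=> [Lz [_ nz]]; apply: contrapT => nPz; apply: nz.
    by move=> /[dup] /PLO[Lz Oz] Pz; split => //; split => // -[_]; apply.
have [G GP] := choice exG.
have [s sL Ls] : exists2 s : seq X, (forall x, x \in s -> L x) &
    L `<=` [set y | exists2 x, x \in s & G x y].
  apply: compact_finite_subcover; first exact: (subclosed_compact clL cX).
  by move=> x /GP[].
suff: forall L', closed L' -> L' `<=` L ->
    L' `<=` [set y | exists2 x, x \in s & G x y] -> disjoint_small_cover small L'.
  by apply.
elim: s sL {Ls} => [_ L' _ _ L's|x s IH xsL L' clL' L'L L's].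
  exists void, (fun=> set0); split => [[]|[]|y /L's[]//].
have [oG sG Gx clLG] := GP _ (xsL x (mem_head _ _)).
have clL'nG : closed (L' `\` G x) by apply: closedI => //; exact: open_closedC.
have clL'G : closed (L' `&` G x).
  rewrite (_ : _ `&` _ = L' `&` (L `&` G x)); first exact: closedI.
  by rewrite setIA (setIidl L'L).
have [||||I [V [V1 V2 V3]]] := IH _ (L' `\` G x) => //.
- by move=> y ys; apply: xsL; rewrite inE ys orbT.
- by move=> z [/L'L].
- move=> z [/L's[y + Gy] nGz]; rewrite inE => /orP[/eqP yx|ys]; last by exists y.
  by rewrite yx in Gy.
have [|N1 [N2 [oN1 oN2 LN1 LN2 N12]]] := disjoint_open_nbhs clL'G clL'nG.
  by apply/seteqP; split => // z [[_ ?] []].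
exists (option I), (fun o => if o is Some i then V i `&` N2 else G x `&` N1).
have dis (A B : set X) : (A `&` N1) `&` (B `&` N2) = set0.
  by rewrite setIACA N12 setI0.
split.
- move=> [i|]; split; [|apply: smallS (V1 i).2| |apply: smallS sG].
  + by apply: openI => //; case: (V1 i).
  + by move=> z [].
  + exact: openI.
  + by move=> z [].
- move=> [i|] [j|] //= ij.
  + by rewrite setIACA V2 ?set0I.
  + by rewrite setIC dis.
- move=> z L'z; have [Gz|nGz] := pselect (G x z).
    by exists None => //; split => //; exact: LN1.
  by have [i _ Vz] := V3 z (conj L'z nGz); exists (Some i) => //; split => //;
    exact: LN2.
Qed.

(** Cover [L1] by disjoint sets [V i] and shrink to a neighbourhood [N]. The cover of [L2] is chosen
    so fine that each member lies in some [V i], and is merged with it, or avoids the closure of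
    [N], and stands alone. *)
Lemma zero_dim_inU L1 L2 : closed L1 ->
  zero_dim_in L1 -> zero_dim_in L2 -> zero_dim_in (L1 `|` L2).
Proof.
move=> clL1 z1 z2 small smallS smallx.
have [I [V [V1 V2 V3]]] := z1 _ smallS smallx.
have oV : open (\bigcup_i V i) by apply: bigcup_open => i _; case: (V1 i).
have [N [oN LN NV]] := compact_shrink clL1 oV V3.
pose inV A i := A `<=` V i.
pose small2 A := small A /\ ((exists i, inV A i) \/ A `<=` ~` closure N).
have [|x|J [H [H1 H2 H3]]] := z2 small2.
- move=> A B AB [sB sB']; split; first exact: smallS sB.
  case: sB' => [[i Bi]|BN]; last by right; exact: subset_trans BN.
  by left; exists i; exact: subset_trans Bi.
- have [G0 [oO sO] Ox] := smallx x.
  have [[i _ Vx]|nVx] := pselect ((\bigcup_i V i) x).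
    exists (G0 `&` V i) => //; split; first by apply: openI => //; case: (V1 i).
    split; first by apply: smallS sO => z [].
    by left; exists i => z [].
  exists (G0 `&` ~` closure N); last by split => // /NV.
  split; first by apply: openI => //; exact/closed_openC/closed_closure.
  split; first by apply: smallS sO => z [].
  by right => z [].
have exf j : exists o : option I,
    if o is Some i then H j `<=` V i else H j `<=` ~` closure N.
  by case: (H1 j) => _ [_ [[i Hi]|HN]]; [exists (Some i)|exists None].
have [f fP] := choice exf.
pose W (k : I + J) := match k with
  | inl i => (V i `&` N) `|` \bigcup_(j in [set j | f j = Some i]) H j
  | inr j => if f j is None then H j else set0 end.
have WV i : W (inl i) `<=` V i.
  move=> z [[]//|[j /= fj Hz]]; have := fP j; rewrite fj; exact.
have disLR i j : W (inl i) `&` W (inr j) = set0.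
  apply/seteqP; split => // z [] /=; case fj : (f j) => [//|].
  have := fP j; rewrite fj => HN.
  move=> [[_ Nz]|[j' /= fj' Hz']] Hz; first exact/(HN _ Hz)/subset_closure.
  have jj' : j' != j by apply/eqP => E; rewrite E fj in fj'.
  by have : (H j' `&` H j) z by []; rewrite H2.
exists (I + J)%type, W; split.
- move=> [i|j]; split.
  + apply: openU; first by apply: openI => //; case: (V1 i).
    by apply: bigcup_open => j _; case: (H1 j).
  + by apply: smallS (V1 i).2; exact: WV.
  + by rewrite /=; case: (f j) => [_|]; [exact: open0|case: (H1 j)].
  + have [_ [sH _]] := H1 j.
    by apply: smallS sH; rewrite /=; case: (f j) => [_ z []|z].
- move=> [i|j] [i'|j'] kk'.
  + have ii' : i != i' by apply: contra kk' => /eqP ->.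
    by apply/seteqP; split => // z [/WV Vi /WV Vi'];
      have : (V i `&` V i') z by []; rewrite V2.
  + exact: disLR.
  + by rewrite setIC disLR.
  + have jj' : j != j' by apply: contra kk' => /eqP ->.
    apply/seteqP; split => // z [] /=.
    case: (f j) => [? []|]; case: (f j') => [? _ []|] h1 h2.
    by have : (H j `&` H j') z by []; rewrite H2.
- move=> z [Lz|Lz].
    by have [i _ Vz] := V3 _ Lz; exists (inl i) => //; left; split => //; exact: LN.
  have [j _ Hz] := H3 _ Lz; case fj : (f j) => [i|].
    by exists (inl i) => //; right; exists j.
  by exists (inr j) => //=; rewrite fj.
Qed.

(* Cutting along the boundaries of finitely many small open sets leaves a
   disjoint family; the cuts form a zero-dimensional set, covered by a second
   disjoint family, so any three members overlap trivially. *)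
Lemma covering_dim_le1 :
  (forall x O, open O -> O x -> exists B L, [/\ open B, B x, B `<=` O &
     [/\ closed L, zero_dim_in L & closure B `\` B `<=` L]]) ->
  covering_dim_le X 1.
Proof.
move=> box k U oU UT.
pose small A := exists i, A `<=` U i.
have smallS A B : A `<=` B -> small B -> small A.
  by move=> AB [i Bi]; exists i; exact: subset_trans Bi.
have smallx x : exists2 O, open O /\ small O & O x.
  have : [set: X] x by []. 
  by rewrite -UT => -[i _ Ux]; exists (U i) => //; split => //; exists i.
have exB x : exists BL : set X * set X, [/\ open BL.1, BL.1 x, small BL.1 &
     [/\ closed BL.2, zero_dim_in BL.2 &
         closure BL.1 `\` BL.1 `<=` BL.2]].
  have [G0 [oO sO] Ox] := smallx x; have [B [L [? ? BO ?]]] := box _ _ oO Ox.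
  by exists (B, L); split => //; exact: smallS sO.
have [BL BLP] := choice exB.
have [s _ sX] := compact_finite_subcover (O := fun x => (BL x).1) cX
  (fun x _ => let: And4 o p _ _ := BLP x in conj o p).
pose Lam := [set y | exists2 x, x \in s & (BL x).2 y].
have : closed Lam /\ zero_dim_in Lam.
  rewrite /Lam; elim: (s) => [|x t [cl zd]].
    rewrite (_ : mkset _ = set0); last by apply/seteqP; split => // y [].
    split; first exact: closed0.
    by move=> P PS _; exists void, (fun=> set0); split => // -[].
  have [_ _ _ [clL tdL _]] := BLP x.
  rewrite (_ : mkset _ = (BL x).2 `|` [set y | exists2 x, x \in t & (BL x).2 y]).
    split; first exact: closedU.
    exact: zero_dim_inU.
  apply/seteqP; split => y /=.
    move=> [z + Lz]; rewrite inE => /orP[/eqP zx|zt]; last by right; exists z.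
    by left; rewrite -zx.
  move=> [Ly|[z zt Lz]]; first by exists x => //; rewrite mem_head.
  by exists z => //; rewrite inE zt orbT.
move=> [clLam zdLam].
have [I [V [V1 V2 V3]]] := zdLam _ smallS smallx.
pose B i := if s is x0 :: _ then (BL (nth x0 s i)).1 else set0.
have BLs i : (i < size s)%N -> exists2 x, x \in s & B i = (BL x).1.
  rewrite /B; case: (s) => // x0 t it; exists (nth x0 (x0 :: t) i) => //.
  exact: mem_nth.
(* Removing closures rather than the sets themselves keeps [O i] open; the points lost lie on
   boundaries, hence in [Lam]. *)
pose O (i : 'I_(size s)) := B i `\` \bigcup_(j in [set j | (j < i)%N]) closure (B j).
pose W (k : I + 'I_(size s)) := match k with inl i => V i | inr i => O i end.
have oW k' : open (W k').
  case: k' => [i|i] /=; first by case: (V1 i).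
  apply: openI.
    by have [x _ ->] := BLs i (ltn_ord i); case: (BLP x).
  apply: closed_openC.
  rewrite bigcup_mkord; elim/big_ind: _ => //; [exact: closed0|exact: closedU|].
  by move=> j _; exact: closed_closure.
have sW k' : small (W k').
  case: k' => [i|i] /=; first by case: (V1 i).
  have [x _ E] := BLs i (ltn_ord i); have [_ _ sB _] := BLP x.
  by apply: smallS sB; rewrite -E => z [].
have disW (k1 k2 : I + 'I_(size s)) : k1 != k2 ->
    (if k1 is inl _ then true else false) = (if k2 is inl _ then true else false) ->
    W k1 `&` W k2 = set0.
  case: k1 k2 => [i|i] [j|j] //= ij _.
    by apply: V2; apply: contra ij => /eqP ->.
  have ij' : (i < j)%N || (j < i)%N.
    by rewrite -neq_ltn; apply: contra ij => /eqP E; apply/eqP; congr inr; exact: val_inj.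
  apply/seteqP; split => // z [[Bi ni] [Bj nj]].
  case/orP: ij' => ij'.
    by apply: nj; exists i => //; exact: subset_closure.
  by apply: ni; exists j => //; exact: subset_closure.
exists #|{: I + 'I_(size s)}|, (fun j => W (enum_val j)); split.
- by move=> j; exact: oW.
- apply/seteqP; split => // y _.
  suff [k' Wk] : exists k', W k' y by exists (enum_rank k') => //; rewrite enum_rankK.
  have [Ly|nLy] := pselect (Lam y).
    by have [i _ Vy] := V3 _ Ly; exists (inl i).
  have exi : exists i, (i < size s)%N && `[< B i y >].
    have [//|x xs Bxy] := sX y; exists (index x s); rewrite index_mem xs /=.
    apply/asboolP; rewrite /B; case: (s) xs => // x0 t xs.
    by rewrite nth_index.
  case: (ex_minnP exi) => i /andP[si /asboolP Bi] imin.
  exists (inr (Ordinal si)); split => // -[j /= ji clBj]; apply: nLy.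
  have sj : (j < size s)%N by exact: ltn_trans si.
  have nBj : ~ B j y.
    by move=> Bj; have := imin j; rewrite sj asboolT // => /(_ isT); rewrite leqNgt ji.
  have [x xs E] := BLs j sj; exists x => //; have [_ _ _ [_ _]] := BLP x; apply.
  by rewrite -E.
- move=> j; have [i Wi] := sW (enum_val j); by exists i.
- move=> t tinj.
  pose side (k' : I + 'I_(size s)) := if k' is inl _ then true else false.
  have [a [b [ab sab]]] : exists a b, a != b /\
      side (enum_val (t a)) = side (enum_val (t b)).
    pose g (a : 'I_3) := side (enum_val (t a)).
    have : ~~ injectiveb g.
      by apply/negP => /injectiveP/leq_card; rewrite card_ord card_bool.
    move=> /injectivePn[a [b ab E]]; by exists a, b.
  apply/seteqP; split => // y Wy.
  have ne : enum_val (t a) != enum_val (t b).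
    by apply: contra ab => /eqP/enum_val_inj/tinj ->.
  have : (W (enum_val (t a)) `&` W (enum_val (t b))) y by split; exact: Wy.
  by rewrite disW.
Qed.

End CompactMetric.

(** * Flows and local cross-sections *)

Lemma archi_invn {R : realType} (d : R) : 0 < d -> exists n : nat, n.+1%:R^-1 < d.
Proof.
move=> d0; exists (Num.truncn d^-1).
rewrite -[ltRHS]invrK ltf_pV2 ?posrE ?invr_gt0 //.
exact: truncnS_gt.
Qed.

Lemma le_invn_le0 {R : realType} (a : R) : (forall n : nat, a <= n.+1%:R^-1) -> a <= 0.
Proof.
move=> h; rewrite leNgt; apply/negP => /archi_invn[n].
by rewrite ltNge h.
Qed.

Lemma le_invnS {R : realType} (n : nat) : n.+2%:R^-1 <= n.+1%:R^-1 :> R.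
Proof. by rewrite lef_pV2 ?posrE ?ler_nat. Qed.

Section Flow.
Context {R : realType} {X : metricType R} (cX : compact [set: X]).
Context (phi : R -> X -> X) (flow : is_flow phi).

Lemma flow0 x : phi 0 x = x.
Proof. by case: flow. Qed.

Lemma flowD t s x : phi (t + s) x = phi s (phi t x).
Proof. by case: flow. Qed.

Lemma flowNK t x : phi (- t) (phi t x) = x.
Proof. by rewrite -flowD subrr flow0. Qed.

Lemma flowKN t x : phi t (phi (- t) x) = x.
Proof. by rewrite -flowD addNr flow0. Qed.

Lemma continuous_flow {T : topologicalType} (f : T -> R) (g : T -> X) :
  continuous f -> continuous g -> continuous (fun t => phi (f t) (g t)).
Proof.
move=> cf cg t.
apply: (@continuous_comp _ _ _ (fun t => (f t, g t))
  (fun p : R * X => phi p.1 p.2)); last by case: flow => + _ _; apply.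
exact: (cvg_pair (cf t) (cg t)).
Qed.

Lemma continuous_flow_time x : continuous (phi ^~ x).
Proof. by apply: continuous_flow => t; [exact: cvg_id|exact: cvg_cst]. Qed.

Lemma continuous_flow_space t : continuous (phi t).
Proof. by apply: continuous_flow => x; [exact: cvg_cst|exact: cvg_id]. Qed.

Lemma flow_unif (T e : R) : 0 < e -> exists2 d : R, 0 < d &
  forall t t' x y, `|t| <= T -> `|t'| <= T -> `|t - t'| <= d -> mdist x y <= d ->
    mdist (phi t x) (phi t' y) <= e.
Proof.
move=> e0; apply: contrapT => H.
pose K : set ((R * X) * (R * X)) := (`[- T, T] `*` setT) `*` (`[- T, T] `*` setT).
have cK : compact K.
  by apply: compact_setX; apply: compact_setX => //; exact: segment_compact.
have c11 : continuous (fun z : (R * X) * (R * X) => z.1.1).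
  by move=> z; apply: continuous_comp; exact: cvg_fst.
have c12 : continuous (fun z : (R * X) * (R * X) => z.1.2).
  by move=> z; apply: continuous_comp; [exact: cvg_fst|exact: cvg_snd].
have c21 : continuous (fun z : (R * X) * (R * X) => z.2.1).
  by move=> z; apply: continuous_comp; [exact: cvg_snd|exact: cvg_fst].
have c22 : continuous (fun z : (R * X) * (R * X) => z.2.2).
  by move=> z; apply: continuous_comp; exact: cvg_snd.
pose F n : set ((R * X) * (R * X)) := [set z | `|z.1.1 - z.2.1| <= n.+1%:R^-1] `&`
  [set z | mdist z.1.2 z.2.2 <= n.+1%:R^-1] `&`
  [set z | e <= mdist (phi z.1.1 z.1.2) (phi z.2.1 z.2.2)].
have [n|n z [[h1 h2] h3]|n|[[t x] [t' y]] _ Fz] := compact_nested (F := F) cK.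
- apply: closedI; first apply: closedI.
  + apply: closed_le_fun; last exact: cst_continuous.
    by move=> z; apply: cvg_norm; apply: cvgB; [exact: c11|exact: c21].
  + by apply: closed_le_fun; [exact: continuous_mdist|exact: cst_continuous].
  + apply: closed_le_fun; first exact: cst_continuous.
    by apply: continuous_mdist; exact: continuous_flow.
- by split => //; split => /=; [apply: le_trans h1 _|apply: le_trans h2 _];
    exact: le_invnS.
- apply: contrapT => E; apply: H; exists n.+1%:R^-1; first by rewrite invr_gt0.
  move=> t t' x y tT t'T tt' xy; rewrite leNgt; apply/negP => lt.
  apply: E; exists ((t, x), (t', y)); split; last by split; [split|exact: ltW].
  by split; split => //=; rewrite in_itv /= -ler_norml.
have : `|t - t'| <= 0 by apply: le_invn_le0 => n; have [[]] := Fz n.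
have : mdist x y <= 0 by apply: le_invn_le0 => n; have [[]] := Fz n.
have [_ /=] := Fz 0%N.
rewrite normr_le0 subr_eq0 => h1 h2 /eqP tt'; move: h1 h2; rewrite tt'.
rewrite [mdist x y <= _]le_eqVlt ltNge mdist_ge0 orbF => + /eqP/mdist_positivity xy.
by rewrite xy mdistxx leNgt e0.
Qed.

Lemma flow_unif_space (T e : R) : 0 < e -> exists2 d : R, 0 < d &
  forall t x y, `|t| <= T -> mdist x y <= d -> mdist (phi t x) (phi t y) <= e.
Proof.
move=> /(flow_unif T)[d d0 H]; exists d => // t x y tT; apply: H => //.
by rewrite subrr normr0 ltW.
Qed.

Lemma flow_unif_time (e : R) : 0 < e -> exists2 d : R, 0 < d &
  forall t x, `|t| <= d -> mdist (phi t x) x <= e.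
Proof.
move=> /(flow_unif 1)[d d0 H]; exists (Num.min d 1); first by rewrite lt_min d0 /=.
move=> t x; rewrite le_min => /andP[td t1].
rewrite -[x in mdist _ x]flow0; apply: H => //.
- by rewrite normr0.
- by rewrite subr0.
- by rewrite mdistxx ltW.
Qed.

(** Otherwise every time [2 ^- n] has a fixed point. Halving the time makes the fixed point sets
    nested, and a common point, having arbitrarily small periods, would be fixed by the flow. *)
Lemma aperiodic_time : regular_flow phi ->
  exists2 tau : R, 0 < tau & forall x, phi tau x <> x.
Proof.
move=> reg; apply: contrapT => H.
pose p (n : nat) : R := 2 ^- n.
have p0 n : 0 < p n by rewrite invr_gt0 exprn_gt0.
have pS n : p n = p n.+1 + p n.+1.
  by rewrite /p exprS invfM; lra.
have cl n : closed [set x | phi (p n) x = x].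
  rewrite (_ : mkset _ = [set x | mdist (phi (p n) x) x <= 0]).
    apply: closed_le_fun; last exact: cst_continuous.
    by apply: continuous_mdist; [exact: continuous_flow_space|move=> ?; exact: cvg_id].
  apply/seteqP; split => x /=; first by move=> ->; rewrite mdistxx.
  by rewrite le_eqVlt ltNge mdist_ge0 orbF => /eqP/mdist_positivity.
have [n x /= px|n|x _ xF] := compact_nested cX cl.
- by rewrite pS flowD !px.
- apply: contrapT => E; apply: H; exists (p n) => // x px.
  by apply: E; exists x.
have xk n k : phi (k%:R * p n) x = x.
  by elim: k => [|k IH]; rewrite ?mul0r ?flow0 // -natr1 mulrDl mul1r flowD IH; exact: xF.
suff fix_pos t : 0 <= t -> phi t x = x.
  apply: (reg x) => t; have [/fix_pos//|/ltW t0] := leP 0 t.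
  by rewrite -{1}(fix_pos (- t)) ?oppr_ge0 // flowKN.
move=> t0; apply/mdist_positivity/eqP; rewrite eq_le mdist_ge0 andbT.
apply/ler_addgt0Pl => e e0; rewrite addr0.
have [d d0 Hd] := flow_unif_time e0.
have [n nd] : exists n, p n < d.
  have [n nd] := archi_invn d0; exists n; apply: le_lt_trans nd.
  rewrite lef_pV2 ?posrE ?exprn_gt0 // -natrX ler_nat.
  exact: ltn_expl.
have tp0 : 0 <= t / p n by rewrite divr_ge0 // ltW.
have /andP[k1 k2] := truncn_itv tp0.
set k := Num.truncn _ in k1 k2.
rewrite ler_pdivlMr // in k1; rewrite ltr_pdivrMr // -natr1 mulrDl mul1r in k2.
rewrite -(subrK (k%:R * p n) t) addrC flowD xk; apply: Hd.
by rewrite ger0_norm; lra.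
Qed.

(* Minimizing [d (phi s x) q - c s] over a time window makes the function grow
   at rate at least [c] along orbits, as long as the right end of the window is
   never optimal; this replaces a smooth local cross-section. *)
Lemma section_function : regular_flow phi -> exists V : X -> X -> R,
  exists c s0 r0 : R, [/\ 0 < c, 0 < s0, 0 < r0,
   forall q x (t1 t2 : R), mdist x q <= r0 -> - s0 <= t1 -> t1 <= t2 -> t2 <= s0 ->
     c * (t2 - t1) <= V q (phi t2 x) - V q (phi t1 x) &
   (forall q q' x, `|V q x - V q' x| <= mdist q q') /\
   (forall e : R, 0 < e -> exists2 d : R, 0 < d & forall q x y, mdist x y <= d ->
     `|V q x - V q y| <= e)].
Proof.
move=> /aperiodic_time[tau tau0 aper].
have [g g0 gP] : exists2 g : R, 0 < g & forall x, 4 * g <= mdist (phi tau x) x.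
  apply: contrapT => H.
  pose F n := [set x | mdist (phi tau x) x <= n.+1%:R^-1].
  have [n|n x /= h|n|x _ xF] := compact_nested (F := F) cX.
  - apply: closed_le_fun; last exact: cst_continuous.
    by apply: continuous_mdist; [exact: continuous_flow_space|move=> ?; exact: cvg_id].
  - by apply: le_trans h _; exact: le_invnS.
  - apply: contrapT => E; apply: H; exists (n.+1%:R^-1 / 4).
      by rewrite divr_gt0 // invr_gt0.
    move=> x; rewrite mulrC divfK // leNgt; apply/negP => /ltW lt.
    by apply: E; exists x.
  apply: (aper x); apply/mdist_positivity/eqP; rewrite eq_le mdist_ge0 andbT.
  exact: le_invn_le0.
(* The linear term over the whole window stays below [g], while time [tau] displaces every point by
   at least [4 * g]; the margin pays for the errors [g / 4] below. *)
have [c c0 ctau] : exists2 c : R, 0 < c & forall s : R, s <= tau -> c * s <= g.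
  exists (g / tau); first by rewrite divr_gt0.
  by move=> s st; rewrite -[leRHS](divfK (lt0r_neq0 tau0)) ler_pM2l ?divr_gt0.
pose f q x s := mdist (phi s x) q - c * s.
have exV (z : X * X) : exists v, (exists2 s : R, 0 <= s <= tau & v = f z.1 z.2 s) /\
    forall s : R, 0 <= s <= tau -> v <= f z.1 z.2 s.
  case: z => q x; have cf : {within `[0, tau], continuous (f q x)}.
    apply: continuous_subspaceT => s; apply: cvgB.
      apply: continuous_mdist; first exact: continuous_flow_time.
      by move=> ?; exact: cvg_cst.
    by apply: cvgM; [exact: cvg_cst|exact: cvg_id].
  have [s s01 smin] := EVT_min (ltW tau0) cf.
  exists (f q x s); split; first by exists s => //; rewrite in_itv in s01.
  by move=> u u01; apply: smin; rewrite in_itv.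
have [W WP] := choice exV.
pose V q x := W (q, x).
have VE q x : exists2 s : R, 0 <= s <= tau & V q x = f q x s by have [] := WP (q, x).
have Vle q x (s : R) : 0 <= s <= tau -> V q x <= f q x s by have [_] := WP (q, x); apply.
have Vdist q q' x x' (e : R) :
    (forall s : R, 0 <= s <= tau -> mdist (phi s x) q <= mdist (phi s x') q' + e) ->
    V q x <= V q' x' + e.
  move=> h; have [s s01 ->] := VE q' x'; apply: le_trans (Vle q x s s01) _.
  by rewrite /f; have := h s s01; lra.
have [s0 s00 Hs0] := flow_unif_time (divr_gt0 g0 (ltr0Sn _ 3)).
exists V, c, s0, (g / 4); split => //; first by rewrite divr_gt0.
- move=> q x t1 t2 xq t1s t12 t2s.
  have [s /andP[s1 s2] E] := VE q (phi t2 x).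
  (* The minimizer for [phi t2 x], delayed by [t2 - t1], reaches the same point from [phi t1 x];
     only the linear term changes, and this is the growth claimed. *)
  have [le|gt] := leP (s + (t2 - t1)) tau.
    have := Vle q (phi t1 x) (s + (t2 - t1)).
    have -> : 0 <= s + (t2 - t1) <= tau by apply/andP; split; lra.
    move=> /(_ isT); rewrite E /f -!flowD (_ : t1 + (s + (t2 - t1)) = t2 + s); last lra.
    by rewrite !mulrDr; lra.
  (* The delayed time leaves the window only if [s] is so close to [tau] that the orbit is near
     [phi tau x], far from [q]; then time 0 would beat [s]. *)
  have := Vle q (phi t2 x) 0; rewrite E lexx (ltW tau0) => /(_ isT).
  rewrite /f flow0 mulr0 subr0 -flowD => le1.
  have w1 : `|s + t2 - tau| <= s0 by rewrite ler_norml; apply/andP; split; lra.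
  have w2 : `|t2| <= s0 by rewrite ler_norml; apply/andP; split; lra.
  have h1 := Hs0 _ (phi tau x) w1; have h2 := Hs0 _ x w2.
  rewrite -flowD (_ : tau + (s + t2 - tau) = t2 + s) in h1; last by lra.
  have h3 := metric_triangle (phi tau x) (phi (t2 + s) x) x.
  have h4 := metric_triangle (phi (t2 + s) x) q x.
  have h5 := metric_triangle (phi t2 x) x q.
  have h6 := gP x; have h7 := ctau s s2.
  rewrite (metric_sym (phi tau x) (phi (t2 + s) x)) in h3; rewrite (metric_sym q x) in h4.
  by exfalso; lra.
- split.
    move=> q q' x; rewrite ler_norml.
    have h1 := @Vdist q q' x x (mdist q q'); have h2 := @Vdist q' q x x (mdist q q').
    apply/andP; split.
      suff : V q' x <= V q x + mdist q q' by lra.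
      by apply: h2 => s _; exact: metric_triangle.
    suff : V q x <= V q' x + mdist q q' by lra.
    by apply: h1 => s _; rewrite (metric_sym q); exact: metric_triangle.
  move=> e /(flow_unif_space tau)[d d0 H]; exists d => // q x y xy.
  have H' (s : R) : 0 <= s <= tau -> mdist (phi s x) (phi s y) <= e.
    by move=> /andP[s1 s2]; apply: H => //; rewrite ger0_norm.
  have h1 := @Vdist q q x y e; have h2 := @Vdist q q y x e.
  rewrite ler_norml; apply/andP; split.
    suff : V q y <= V q x + e by lra.
    apply: h2 => s /H'; have := metric_triangle (phi s y) (phi s x) q.
    by rewrite (metric_sym (phi s y) (phi s x)); lra.
  suff : V q x <= V q y + e by lra.
  apply: h1 => s /H'.
  by have := metric_triangle (phi s x) (phi s y) q; lra.
Qed.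

End Flow.

(** * Piecewise linear reparametrizations *)

Section Reparametrization.
Context {R : realType}.
Implicit Types (g h : R -> R) (a b : nat -> R) (s t m M : R) (k n : nat).

Definition growth_between m M g :=
  forall s t, s <= t -> m * (t - s) <= g t - g s <= M * (t - s).

Lemma growth_continuous m M g : growth_between m M g -> 0 < m -> continuous g.
Proof.
move=> gP m0.
have M0 : 0 <= M by have /andP[] := gP 0 1 ler01; rewrite subr0 !mulr1; lra.
have key s t : s <= t -> `|g t - g s| <= M * `|t - s|.
  move=> st; have /andP[h1 h2] := gP _ _ st.
  have st0 : 0 <= t - s by rewrite subr_ge0.
  by rewrite !ger0_norm //; apply: le_trans h1; rewrite mulr_ge0 // ltW.
move=> t; apply/cvgrPdist_le => e e0.
have M1 : 0 < M + 1 by lra.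
near=> s.
have : `|t - s| <= e / (M + 1).
  by near: s; apply: cvgr_dist_le; [exact: cvg_id|rewrite divr_gt0].
rewrite ler_pdivlMr // => ts; apply: le_trans ts.
apply: (@le_trans _ _ (M * `|t - s|)); last by rewrite mulrC ler_wpM2l //; lra.
by have [/key//|/ltW/key] := leP s t; rewrite distrC [in leRHS]distrC.
Unshelve. all: by end_near. Qed.

Lemma growth_surj m M g : growth_between m M g -> 0 < m -> g 0 = 0 ->
  forall t, exists s, g s = t.
Proof.
move=> gP m0 g0 t; pose r := `|t| / m.
have r0 : 0 <= r by rewrite divr_ge0 // ltW.
have mr : m * r = `|t| by rewrite mulrC divfK // gt_eqF.
have h1 : t <= g r.
  have /andP[+ _] := gP _ _ r0; rewrite g0 !subr0 mr; apply: le_trans.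
  exact: ler_norm.
have h2 : g (- r) <= t.
  have Nr0 : - r <= 0 by rewrite oppr_le0.
  have /andP[+ _] := gP _ _ Nr0; rewrite g0 !sub0r opprK mr.
  by have := ler_norm (- t); rewrite normrN; lra.
have [|||s _ <-] := @IVT R g (- r) r t; last by exists s.
- lra.
- by apply: continuous_subspaceT; exact: (growth_continuous gP).
- by rewrite ge_min le_max h1 h2 orbT.
Qed.

Lemma growth_inverse m M g : growth_between m M g -> 0 < m -> 0 < M -> g 0 = 0 ->
  exists g', [/\ cancel g g', cancel g' g, g' 0 = 0 & growth_between M^-1 m^-1 g'].
Proof.
move=> gP m0 M0 g0.
have [g' g'P] := choice (growth_surj gP m0 g0).
have ginj : injective g.
  suff H s t : s <= t -> g s = g t -> s = t.
    by move=> s t E; have [/H/(_ E)|/ltW/H/(_ (esym E))] := leP s t.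
  move=> st E; have /andP[+ _] := gP _ _ st.
  rewrite E subrr pmulr_rle0 // subr_le0 => ts.
  by apply/eqP; rewrite eq_le st ts.
have gg' : cancel g g' by move=> s; apply: ginj; rewrite g'P.
exists g'; split => //; first by rewrite -g0 gg'.
move=> s t st.
have st' : g' s <= g' t.
  rewrite leNgt; apply/negP => /[dup] lt /ltW /gP /andP[+ _]; rewrite !g'P.
  have : 0 < m * (g' s - g' t) by rewrite mulr_gt0 // subr_gt0.
  by lra.
have /andP[h1 h2] := gP _ _ st'; rewrite !g'P in h1 h2.
by rewrite ler_pdivrMl // ler_pdivlMl // h1 h2.
Qed.

Lemma growth_comp m M m' M' g h : growth_between m M g -> growth_between m' M' h ->
  0 < m -> 0 < m' -> growth_between (m * m') (M * M') (g \o h).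
Proof.
move=> gP hP m0 m'0 s t st; have /andP[h1 h2] := hP _ _ st.
have hst : h s <= h t by rewrite -subr_ge0 (le_trans _ h1) // mulr_ge0 ?subr_ge0 // ltW.
have /andP[g1 g2] := gP _ _ hst => /=.
have M0 : 0 <= M by have /andP[] := gP 0 1 ler01; rewrite subr0 !mulr1; lra.
apply/andP; split.
  by apply: le_trans g1; rewrite -mulrA ler_pM2l.
by apply: (le_trans g2); rewrite -mulrA ler_wpM2l.
Qed.

Lemma growth_Rep m M g : growth_between m M g -> 0 < m -> 0 < M -> g 0 = 0 -> Rep g.
Proof.
move=> gP m0 M0 g0; split => //.
- move=> s t st; have /andP[+ _] := gP _ _ (ltW st).
  by rewrite -(subr_gt0 (g s)); apply: lt_le_trans; rewrite mulr_gt0 ?subr_gt0.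
- exact: growth_continuous gP m0.
have [g' [c1 c2 g'0 g'P]] := growth_inverse gP m0 M0 g0.
by exists g'; split => //; apply: growth_continuous g'P _; rewrite invr_gt0.
Qed.

Let clamp t : R := Num.min (Num.max t 0) 1.

Let clamp_id t : 0 <= t <= 1 -> clamp t = t.
Proof.
by move=> /andP[t0 t1]; rewrite /clamp (max_l t0) (min_l t1).
Qed.

Let clamp0 t : t <= 0 -> clamp t = 0.
Proof. by move=> t0; rewrite /clamp (max_r t0) min_l. Qed.

Let clamp1 t : 1 <= t -> clamp t = 1.
Proof. by move=> t1; rewrite /clamp max_l ?min_r //; lra. Qed.

Let clamp_homo s t : s <= t -> clamp s <= clamp t.
Proof.
move=> st; have [s0|s0] := leP s 0.
  by rewrite (clamp0 s0) /clamp le_min le_max lexx orbT ler01.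
have [t1|t1] := leP 1 t; first by rewrite (clamp1 t1) /clamp ge_min lexx orbT.
by rewrite !clamp_id //; apply/andP; split; lra.
Qed.

(** The case of constant slope 1; it lets bounds on the slopes of [pw_linear] be summed term by
    term. *)
Let sum_clamp n t : t <= n%:R -> \sum_(i < n) clamp (t - i%:R) = Num.max t 0.
Proof.
have big n' s : n'%:R <= s -> \sum_(i < n') clamp (s - i%:R) = n'%:R.
  move=> ns; under eq_bigr => i _.
    rewrite clamp1; first over.
    have : i.+1%:R <= n'%:R :> R by rewrite ler_nat.
    by rewrite -natr1; lra.
  by rewrite sumr_const card_ord.
elim: n => [|n IH] tn; first by rewrite big_ord0 max_r.
rewrite big_ord_recr /=; have [le|lt] := leP t n%:R.
  by rewrite IH // clamp0 ?addr0 // subr_le0.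
rewrite big ?ltW // clamp_id; last by apply/andP; split; [lra|rewrite -natr1 in tn; lra].
by rewrite addrC subrK max_l // (le_trans _ (ltW lt)).
Qed.

Definition partial_sum a n := \sum_(i < n) a i.

Lemma partial_sumS a n : partial_sum a n.+1 = partial_sum a n + a n.
Proof. by rewrite /partial_sum big_ord_recr. Qed.

(* The piecewise linear function with slope [a i] on [[i, i + 1]], vanishing
   on the negative half-line. *)
Definition pw_linear a t := \sum_(i < (Num.truncn t).+1) a i * clamp (t - i%:R).

(** Terms beyond [t] vanish, so the values at two arguments can be compared as sums of the same
    length. *)
Let pw_linearE a t n : t <= n%:R -> pw_linear a t = \sum_(i < n) a i * clamp (t - i%:R).
Proof.
have ext k : t <= k%:R -> forall j, \sum_(i < k + j) a i * clamp (t - i%:R) =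
    \sum_(i < k) a i * clamp (t - i%:R).
  move=> tk; elim=> [|j IH]; first by rewrite addn0.
  rewrite addnS big_ord_recr /= IH clamp0 ?mulr0 ?addr0 //.
  by rewrite subr_le0 (le_trans tk) // ler_nat leq_addr.
move=> tn; have tt : t <= (Num.truncn t).+1%:R by exact/ltW/truncnS_gt.
have [le|/ltnW le] := leqP n (Num.truncn t).+1.
  by rewrite /pw_linear -(subnKC le) ext.
by rewrite -(subnKC le) ext.
Qed.

Lemma pw_linear_node a k t : 0 <= t <= 1 ->
  pw_linear a (k%:R + t) = partial_sum a k + t * a k.
Proof.
move=> t01; rewrite (@pw_linearE _ _ k.+1); last first.
  by rewrite -natr1; case/andP: t01 => _; lra.
rewrite big_ord_recr /= addrAC subrr add0r clamp_id // mulrC; congr (_ + _).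
apply: eq_bigr => i _; rewrite clamp1 ?mulr1 //.
have : i.+1%:R <= k%:R :> R by rewrite ler_nat.
by rewrite -natr1; case/andP: t01; lra.
Qed.

Let pw_linear_growth a m M s t : (forall i, m <= a i <= M) -> s <= t ->
  m * (Num.max t 0 - Num.max s 0) <= pw_linear a t - pw_linear a s
    <= M * (Num.max t 0 - Num.max s 0).
Proof.
move=> aP st; pose n := (Num.truncn t).+1.
have tn : t <= n%:R by exact/ltW/truncnS_gt.
have sn : s <= n%:R by exact: le_trans tn.
rewrite !(@pw_linearE _ _ n) // -!(@sum_clamp n) // -!sumrB !mulr_sumr.
apply/andP; split; apply: ler_sum => i _; rewrite -mulrBr ler_wpM2r //.
- by rewrite subr_ge0 clamp_homo // lerB.
- by case/andP: (aP i).
- by rewrite subr_ge0 clamp_homo // lerB.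
- by case/andP: (aP i).
Qed.

Let pw_linear0 a t : t <= 0 -> pw_linear a t = 0.
Proof. by move=> t0; rewrite (@pw_linearE _ _ 0) ?big_ord0. Qed.

(** The slopes [b] are indexed away from 0: the slope on [[- (i + 1), - i]] is [b i]. *)
Definition two_sided a b t := pw_linear a t - pw_linear b (- t).

Lemma two_sided_growth a b m M : (forall i, m <= a i <= M) ->
  (forall i, m <= b i <= M) -> growth_between m M (two_sided a b).
Proof.
move=> aP bP s t st; have Nst : - t <= - s by rewrite lerN2.
have /andP[a1 a2] := pw_linear_growth aP st.
have /andP[b1 b2] := pw_linear_growth bP Nst.
have E x : Num.max x 0 - Num.max (- x) 0 = x :> R.
  have [x0|x0] := leP 0 x.
    by rewrite max_r ?subr0 // oppr_le0.
  by rewrite max_l ?sub0r ?opprK // oppr_ge0 ltW.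
have Es := E s; have Et := E t.
rewrite (_ : t - s = (Num.max t 0 - Num.max s 0) +
  (Num.max (- s) 0 - Num.max (- t) 0)); last by lra.
by rewrite /two_sided !mulrDr; apply/andP; split; lra.
Qed.

Lemma two_sided_node a b k t : 0 <= t <= 1 ->
  two_sided a b (k%:R + t) = partial_sum a k + t * a k /\
  two_sided a b (- (k%:R + t)) = - (partial_sum b k + t * b k).
Proof.
move=> t01; have kt : 0 <= k%:R + t by rewrite addr_ge0 //; case/andP: t01.
by rewrite /two_sided opprK !pw_linear_node // !pw_linear0 ?oppr_le0 // subr0 sub0r.
Qed.

(** Both clocks are functions of a common step parameter: [h] returns from the first clock to the
    parameter and proceeds to the second. Slopes [a], [a'] are step durations in the future, [b],
    [b'] in the past. *)
Lemma Rep_matching a b a' b' m M : 0 < m ->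
  (forall i, m <= a i <= M) -> (forall i, m <= b i <= M) ->
  (forall i, m <= a' i <= M) -> (forall i, m <= b' i <= M) ->
  exists2 h, Rep h & forall t, exists k s, 0 <= s <= 1 /\
    ((t = partial_sum a k + s * a k /\ h t = partial_sum a' k + s * a' k) \/
     (t = - (partial_sum b k + s * b k) /\ h t = - (partial_sum b' k + s * b' k))).
Proof.
move=> m0 aP bP a'P b'P; have M0 : 0 < M by have /andP[] := aP 0%N; lra.
have g1 := two_sided_growth aP bP; have g2 := two_sided_growth a'P b'P.
have z c d : two_sided c d 0 = 0 by rewrite /two_sided oppr0 !pw_linear0 ?subrr.
have [g' [c1 c2 g'0 g'P]] := growth_inverse g1 m0 M0 (z _ _).
exists (two_sided a' b' \o g').
  have M'0 : 0 < M^-1 by rewrite invr_gt0.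
  have m'0 : 0 < m^-1 by rewrite invr_gt0.
  apply: (growth_Rep (growth_comp g2 g'P m0 M'0)); rewrite ?mulr_gt0 //=.
  by rewrite g'0 z.
move=> t; rewrite -(c2 t) /= c1; move: (g' t) => {}t.
have [t0|/ltW t0] := leP 0 t.
  have /andP[k1 k2] := truncn_itv t0.
  have s01 : 0 <= t - (Num.truncn t)%:R <= 1.
    by rewrite -natr1 in k2; apply/andP; split; lra.
  have E : t = (Num.truncn t)%:R + (t - (Num.truncn t)%:R) by lra.
  exists (Num.truncn t), (t - (Num.truncn t)%:R); split => //; left.
  by rewrite [in LHS]E [X in _ /\ two_sided _ _ X = _]E !(two_sided_node _ _ _ s01).1.
have t'0 : 0 <= - t by rewrite oppr_ge0.
have /andP[k1 k2] := truncn_itv t'0.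
set k := Num.truncn (- t) in k1 k2.
have s01 : 0 <= - t - k%:R <= 1.
  by rewrite -natr1 in k2; apply/andP; split; lra.
have E : t = - (k%:R + (- t - k%:R)) by lra.
exists k, (- t - k%:R); split => //; right.
by rewrite [in LHS]E [X in _ /\ two_sided _ _ X = _]E !(two_sided_node _ _ _ s01).2.
Qed.

End Reparametrization.

(** * Synchronized orbits and uniform expansivity *)

Definition reverse_flow {R : realType} {X : metricType R} (phi : R -> X -> X) :=
  fun t x => phi (- t) x.

(** The properties of [section_function] as a predicate on the flow, so that they can be transported
    to the reversed flow and past and future share one argument. *)
Definition local_sections {R : realType} {X : metricType R} (phi : R -> X -> X)
    (V : X -> X -> R) (c s0 r0 : R) :=
  [/\ 0 < c, 0 < s0, 0 < r0,
   forall q x (t1 t2 : R), mdist x q <= r0 -> - s0 <= t1 -> t1 <= t2 -> t2 <= s0 ->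
     c * (t2 - t1) <= V q (phi t2 x) - V q (phi t1 x) &
   (forall q q' x, `|V q x - V q' x| <= mdist q q') /\
   (forall e : R, 0 < e -> exists2 d : R, 0 < d & forall q x y, mdist x y <= d ->
     `|V q x - V q y| <= e)].

(* The two orbits run on separate clocks, since expansivity allows a time change. *)
Fixpoint tracked {R : realType} {X : metricType R} (phi : R -> X -> X)
    (eta eps : R) n (x y : X) : Prop :=
  mdist x y <= eps /\
  if n is m.+1 then
    exists2 ab : R * R, (eta / 2 <= ab.1 <= 2 * eta) /\ (eta / 2 <= ab.2 <= 2 * eta) &
      tracked phi eta eps m (phi ab.1 x) (phi ab.2 y)
  else True.

Section Tracking.
Context {R : realType} {X : metricType R} (cX : compact [set: X]).
Implicit Types (phi : R -> X -> X) (V : X -> X -> R) (x y q : X).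

Lemma reverse_flowK phi : reverse_flow (reverse_flow phi) = phi.
Proof. by apply/funext => t; apply/funext => x; rewrite /reverse_flow opprK. Qed.

Lemma is_flow_reverse phi : is_flow phi -> is_flow (reverse_flow phi).
Proof.
move=> flow; split; rewrite /reverse_flow.
- apply: (continuous_flow flow) => p; last exact: cvg_snd.
  by apply: cvgN; exact: cvg_fst.
- by move=> x; rewrite oppr0 flow0.
- by move=> t s x; rewrite opprD flowD.
Qed.

Lemma local_sections_reverse phi V c s0 r0 : local_sections phi V c s0 r0 ->
  local_sections (reverse_flow phi) (fun q x => - V q x) c s0 r0.
Proof.
move=> [c0 s00 r00 M [Cq C]]; split => //; last split.
- move=> q x t1 t2 xq t1s t12 t2s; rewrite /reverse_flow.
  have := M q x (- t2) (- t1) xq; rewrite !lerN2 => /(_ t2s t12).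
  by rewrite lerNl => /(_ t1s); lra.
- by move=> q q' x; rewrite -opprD normrN.
- move=> e /C[d d0 H]; exists d => // q x y /H.
  by rewrite -opprD normrN.
Qed.

Lemma local_sections_continuous phi V c s0 r0 : local_sections phi V c s0 r0 ->
  continuous (fun z : X * X => V z.1 z.2).
Proof.
move=> [_ _ _ _ [Cq C]] [q x]; apply/cvgrPdist_le => e e0 /=.
have e20 : 0 < e / 2 by rewrite divr_gt0.
have [d d0 H] := C _ e20.
exists ([set q' | mdist q q' < e / 2], [set x' | mdist x x' < d]).
  by split; apply/mdist_nbhsP; [exists (e / 2)|exists d].
move=> [q' x'] /= [h1 h2]; have := H q _ _ (ltW h2); have := Cq q q' x'.
by rewrite !ler_norml => /andP[? ?] /andP[? ?]; apply/andP; split; lra.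
Qed.

Lemma section_crossing phi V c s0 r0 q z (u : R) : is_flow phi ->
  local_sections phi V c s0 r0 -> mdist z q <= r0 -> 0 <= u <= s0 ->
  `|V q z - V q q| <= c * u -> exists2 s : R, `|s| <= u & V q (phi s z) = V q q.
Proof.
move=> flow LS zq /andP[u0 us] Vz; have [c0 s00 r00 M _] := LS.
have cV := local_sections_continuous LS.
pose f s := V q (phi s z).
have cf : {within `[- u, u], continuous f}.
  apply: continuous_subspaceT => s.
  apply: (@continuous_comp _ _ _ (fun s => (q, phi s z)) (fun z : X * X => V z.1 z.2)).
    have cq : continuous (fun _ : R => q) by move=> ?; exact: cvg_cst.
    have ct : continuous (fun s : R => phi s z) by exact: continuous_flow_time.
    exact: (cvg_pair (cq s) (ct s)).
  exact: cV.
have [h1 h2] : f (- u) <= V q q /\ V q q <= f u.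
  move: Vz; rewrite ler_norml => /andP[v1 v2].
  have a1 : c * u <= V q z - f (- u).
    have := M q z (- u) 0 zq; rewrite flow0 // sub0r opprK.
    by apply; rewrite ?lerN2 ?oppr_le0 // ltW.
  have a2 : c * u <= f u - V q z.
    by have := M q z 0 u zq; rewrite flow0 // subr0; apply; rewrite ?oppr_le0 // ltW.
  by split; lra.
have [||s sI fs] := @IVT R f (- u) u (V q q) _ cf.
- by rewrite (le_trans _ u0) // oppr_le0.
- by rewrite ge_min le_max h1 h2 orbT.
by exists s => //; rewrite ler_norml; move: sI; rewrite in_itv.
Qed.

Section Clocks.
Context (phi : R -> X -> X) (eta eps : R) (flow : is_flow phi).
Let tr := tracked phi eta eps.

Lemma tracked_dist n x y : tr n x y -> mdist x y <= eps.
Proof. by case: n => [|n] []. Qed.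

Lemma trackedW n x y : tr n.+1 x y -> tr n x y.
Proof.
elim: n x y => [|n IH] x y [xy [ab abP tab]]; split => //.
by exists ab => //; exact: IH.
Qed.

Let steps : set (R * R) := `[eta / 2, 2 * eta] `*` `[eta / 2, 2 * eta].

Let compact_steps : compact steps.
Proof. by apply: compact_setX; exact: segment_compact. Qed.

(** The step durations range over a compact square, so the existential over them is a projection
    along a compact factor. *)
Lemma closed_tracked n : closed [set z : X * X | tr n z.1 z.2].
Proof.
have cd : closed [set z : X * X | mdist z.1 z.2 <= eps].
  apply: closed_le_fun; last exact: cst_continuous.
  exact: mdist_continuous.
elim: n => [|n IH].
  rewrite (_ : mkset _ = [set z : X * X | mdist z.1 z.2 <= eps]) //.
  by apply/seteqP; split => z /=; [case|].
pose C : set ((R * R) * (X * X)) :=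
  [set w | tr n (phi w.1.1 w.2.1) (phi w.1.2 w.2.2)].
have clC : closed C.
  pose f (w : (R * R) * (X * X)) := (phi w.1.1 w.2.1, phi w.1.2 w.2.2).
  have c1 : continuous (fun w : (R * R) * (X * X) => phi w.1.1 w.2.1).
    apply: (continuous_flow flow) => w; first by apply: continuous_comp; exact: cvg_fst.
    by apply: continuous_comp; [exact: cvg_snd|exact: cvg_fst].
  have c2 : continuous (fun w : (R * R) * (X * X) => phi w.1.2 w.2.2).
    apply: (continuous_flow flow) => w; last by apply: continuous_comp; exact: cvg_snd.
    by apply: continuous_comp; [exact: cvg_fst|exact: cvg_snd].
  rewrite (_ : C = f @^-1` [set z : X * X | tr n z.1 z.2]) //.
  by apply: closed_comp => // w _; exact: (cvg_pair (c1 w) (c2 w)).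
rewrite (_ : mkset _ = [set z : X * X | mdist z.1 z.2 <= eps] `&`
    [set z | exists2 ab, steps ab & C (ab, z)]).
  by apply: closedI => //; exact: closed_projection.
apply/seteqP; split => -[x y] /= [xy [ab abP tab]]; split => //; exists ab => //.
Qed.

(** The first step may depend on [n], but the admissible first steps form nested nonempty compact
    sets; a common element continues for every [n]. *)
Lemma tracked_forever_step x y : (forall n, tr n x y) ->
  exists2 ab : R * R, (eta / 2 <= ab.1 <= 2 * eta) /\ (eta / 2 <= ab.2 <= 2 * eta) &
    forall n, tr n (phi ab.1 x) (phi ab.2 y).
Proof.
move=> txy; pose F n := [set ab : R * R | tr n (phi ab.1 x) (phi ab.2 y)].
have [n|n ab|n|ab sab abF] := compact_nested (F := F) compact_steps.
- pose f (w : R * R) := (phi w.1 x, phi w.2 y).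
  have c1 : continuous (fun w : R * R => phi w.1 x).
    by apply: (continuous_flow flow) => w; [exact: cvg_fst|exact: cvg_cst].
  have c2 : continuous (fun w : R * R => phi w.2 y).
    by apply: (continuous_flow flow) => w; [exact: cvg_snd|exact: cvg_cst].
  rewrite (_ : F n = f @^-1` [set z : X * X | tr n z.1 z.2]) //.
  apply: closed_comp; last exact: closed_tracked.
  by move=> w _; exact: (cvg_pair (c1 w) (c2 w)).
- exact: trackedW.
- have [_ [ab [h1 h2] tab]] := txy n.+1; by exists ab.
- by exists ab.
Qed.

Lemma tracked_forever x y : (forall n, tr n x y) ->
  exists a b : nat -> R,
    [/\ forall i, eta / 2 <= a i <= 2 * eta, forall i, eta / 2 <= b i <= 2 * eta &
      forall k, mdist (phi (partial_sum a k) x) (phi (partial_sum b k) y) <= eps].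
Proof.
move=> txy.
have exf (z : X * X) : exists ab : R * R, (forall n, tr n z.1 z.2) ->
    [/\ eta / 2 <= ab.1 <= 2 * eta, eta / 2 <= ab.2 <= 2 * eta &
     forall n, tr n (phi ab.1 z.1) (phi ab.2 z.2)].
  have [/tracked_forever_step[ab [h1 h2] h3]|nt] := pselect (forall n, tr n z.1 z.2).
    by exists ab.
  by exists (0, 0).
have [f fP] := choice exf.
pose next z := (phi (f z).1 z.1, phi (f z).2 z.2).
pose z k := iter k next (x, y).
have zt k : forall n, tr n (z k).1 (z k).2.
  by elim: k => [//|k IH] n; have [_ _] := fP _ IH; apply.
exists (fun i => (f (z i)).1), (fun i => (f (z i)).2); split.
- by move=> i; have [] := fP _ (zt i).
- by move=> i; have [] := fP _ (zt i).
move=> k.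
have zE : z k = (phi (partial_sum (fun i => (f (z i)).1) k) x,
    phi (partial_sum (fun i => (f (z i)).2) k) y).
  elim: k => [|k IH]; first by rewrite /partial_sum !big_ord0 !flow0.
  rewrite !partial_sumS !flowD //.
  have -> : z k.+1 = next (z k) by [].
  by rewrite /next; congr (phi _ _, phi _ _); rewrite IH.
by have := tracked_dist (zt k 0); rewrite {1 2}zE.
Qed.

End Clocks.

(** At the nodes the orbits are [eps]-close; between nodes each moves by at most [w], whence
    [eps + 2 * w]. *)
Lemma tracked_reparam phi (eta eps w : R) x y : is_flow phi -> 0 < eta ->
  (forall t z, `|t| <= 2 * eta -> mdist (phi t z) z <= w) ->
  (forall n, tracked phi eta eps n x y) ->
  (forall n, tracked (reverse_flow phi) eta eps n x y) ->
  exists2 h, Rep h & forall t, mdist (phi t x) (phi (h t) y) <= eps + 2 * w.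
Proof.
move=> flow eta0 wP txy t'xy.
have [a [a' [aP a'P aa']]] := tracked_forever flow txy.
have [b [b' [bP b'P bb']]] := tracked_forever (is_flow_reverse flow) t'xy.
have m0 : 0 < eta / 2 by rewrite divr_gt0.
have [h Rh hP] := Rep_matching m0 aP bP a'P b'P.
exists h => // t.
have close s s' x' y' : `|s| <= 2 * eta -> `|s'| <= 2 * eta -> mdist x' y' <= eps ->
    mdist (phi s x') (phi s' y') <= eps + 2 * w.
  move=> hs hs' h3; have h1 := wP _ x' hs; have h2 := wP _ y' hs'.
  have := metric_triangle (phi s x') x' (phi s' y').
  have := metric_triangle x' y' (phi s' y').
  by rewrite (metric_sym y' (phi s' y')); lra.
have small s u : 0 <= s <= 1 -> eta / 2 <= u <= 2 * eta -> `|s * u| <= 2 * eta.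
  move=> /andP[s0 s1] /andP[u0 u1]; have u0' : 0 <= u by lra.
  by rewrite ger0_norm ?mulr_ge0 // (le_trans _ u1) // ler_piMl.
have [k [s [s01 [[-> ->]|[-> ->]]]]] := hP t.
  by rewrite !flowD //; apply: close; [exact: small|exact: small|exact: aa'].
rewrite !opprD !flowD //; apply: close; rewrite ?normrN; [exact: small|exact: small|].
exact: bb'.
Qed.

Definition uniformly_expansive phi V (r0 eta eps : R) :=
  forall e : R, 0 < e -> exists N, forall q x y, mdist x q <= r0 -> mdist y q <= r0 ->
    V q x = V q y -> tracked phi eta eps N x y ->
    tracked (reverse_flow phi) eta eps N x y -> mdist x y < e.

(** A failure for every [N] passes to a limit: two points of one level of [V q], at distance at
    least [e], tracked forever both ways. Expansivity puts them on one short orbit arc, and [V q]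
    increases strictly along it. *)
Lemma uniform_expansivity phi V c s0 r0 (eta eps w delta : R) :
  is_flow phi -> local_sections phi V c s0 r0 -> 0 < eta ->
  (forall t z, `|t| <= 2 * eta -> mdist (phi t z) z <= w) -> eps + 2 * w <= delta ->
  (forall x y h, Rep h -> (forall t, mdist (phi t x) (phi (h t) y) <= delta) ->
     exists2 s, - s0 <= s <= s0 & y = phi s x) ->
  uniformly_expansive phi V r0 eta eps.
Proof.
move=> flow LS eta0 wP ew expa e e0; apply: contrapT => H.
have cV := local_sections_continuous LS.
pose F n : set (X * (X * X)) := [set z | mdist z.2.1 z.1 <= r0] `&`
  [set z | mdist z.2.2 z.1 <= r0] `&` [set z | V z.1 z.2.1 <= V z.1 z.2.2] `&`
  [set z | V z.1 z.2.2 <= V z.1 z.2.1] `&`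
  [set z | e <= mdist z.2.1 z.2.2] `&`
  [set z | tracked phi eta eps n z.2.1 z.2.2] `&`
  [set z | tracked (reverse_flow phi) eta eps n z.2.1 z.2.2].
have c1 : continuous (fun z : X * (X * X) => z.1) by move=> z; exact: cvg_fst.
have c2 : continuous (fun z : X * (X * X) => z.2) by move=> z; exact: cvg_snd.
have c21 : continuous (fun z : X * (X * X) => z.2.1).
  by move=> z; apply: continuous_comp; [exact: cvg_snd|exact: cvg_fst].
have c22 : continuous (fun z : X * (X * X) => z.2.2).
  by move=> z; apply: continuous_comp; exact: cvg_snd.
have cV' (f : X * (X * X) -> X) : continuous f -> continuous (fun z => V z.1 (f z)).
  move=> cf z; apply: (@continuous_comp _ _ _ (fun z => (z.1, f z))
    (fun z : X * X => V z.1 z.2)); last exact: cV.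
  exact: (cvg_pair (c1 z) (cf z)).
have clT psi n : is_flow psi ->
    closed [set z : X * (X * X) | tracked psi eta eps n z.2.1 z.2.2].
  move=> psiF; rewrite (_ : mkset _ = (fun z : X * (X * X) => z.2) @^-1`
    [set z : X * X | tracked psi eta eps n z.1 z.2]) //.
  by apply: closed_comp; [move=> z _; exact: c2|exact: closed_tracked].
have cX3 : compact [set: X * (X * X)].
  rewrite -setXTT -(@setXTT X X).
  by apply: compact_setX => //; exact: compact_setX.
have [n|n [q [x y]]|n|[q [x y]] _ zF] := compact_nested (F := F) cX3.
- repeat apply: closedI.
  + by apply: closed_le_fun; [exact: continuous_mdist|exact: cst_continuous].
  + by apply: closed_le_fun; [exact: continuous_mdist|exact: cst_continuous].
  + by apply: closed_le_fun; exact: cV'.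
  + by apply: closed_le_fun; exact: cV'.
  + by apply: closed_le_fun; [exact: cst_continuous|exact: continuous_mdist].
  + exact: clT.
  + exact/clT/is_flow_reverse.
- by move=> [[[[[[h1 h2] h3] h4] h5] /trackedW h6] /trackedW h7].
- apply: contrapT => E; apply: H; exists n => q x y xq yq VE t1 t2.
  rewrite ltNge; apply/negP => exy; apply: E; exists (q, (x, y)).
  by split => //; repeat split => //=; rewrite VE.
have t1 n : tracked phi eta eps n x y by have [[]] := zF n.
have t2 n : tracked (reverse_flow phi) eta eps n x y by have [] := zF n.
have [h Rh hP] := tracked_reparam flow eta0 wP t1 t2.
have [|s /andP[s1 s2] yE] := expa x y h Rh.
  by move=> t; apply: le_trans ew.
have [[[[[[/= xq yq] V1] V2] exy] _] _] := zF 0%N.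
have [c0 s00 r00 M _] := LS.
have VE : V q x = V q y by apply/eqP; rewrite eq_le V1 V2.
suff s0E : s = 0 by move: exy; rewrite yE s0E flow0 // mdistxx leNgt e0.
have [s_ge|s_le] := leP 0 s.
  have := M q x 0 s xq; rewrite flow0 // -yE VE subrr subr0 pmulr_rle0 // => h'.
  by apply/eqP; rewrite eq_le s_ge h' //; lra.
have := M q x s 0 xq; rewrite flow0 // -yE VE subrr sub0r pmulr_rle0 // => h'.
by have := h' s1 (ltW s_le) (ltW s00); lra.
Qed.

End Tracking.

(** * Growth of continua *)

Section UniformOn.
Context {R : realType} {X : metricType R} (cX : compact [set: X]).
Implicit Types (C : set X) (F : X -> X).

(** The maps [F] below are assembled from hitting times chosen point by point and are controlled
    only on [C]; explicit moduli compose without subspace topologies. *)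
Definition uniform_on C F := forall e : R, 0 < e -> exists2 d : R, 0 < d &
  forall x y, C x -> C y -> mdist x y <= d -> mdist (F x) (F y) <= e.

Lemma uniform_on_within C F : uniform_on C F -> {within C, continuous F}.
Proof.
move=> unifF; apply/subspace_continuousP => x Cx.
apply/metricType_numDomainType.cvgrPdist_le => e /unifF[d d0 H].
rewrite near_withinE; near=> y => Cy; apply: H => //.
by apply/ltW; near: y; apply/mdist_nbhsP; exists d.
Unshelve. all: by end_near. Qed.

Lemma uniform_on_image C F : closed C -> connected C -> uniform_on C F ->
  closed (F @` C) /\ connected (F @` C).
Proof.
move=> clC cC /uniform_on_within cF; split.
  by apply: compactX_closed; apply: continuous_compact => //; exact: compactT_closed.
exact: connected_continuous_connected.
Qed.

End UniformOn.

(** * Growing, splitting and selecting continua *)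

Section Engine.
Context {R : realType} {X : metricType R} (cX : compact [set: X]).
Context (phi : R -> X -> X) (flow : is_flow phi).
Context (V : X -> X -> R) (c s0 r0 : R) (LS : local_sections phi V c s0 r0).
Context (eta eps : R) (eta0 : 0 < eta) (etas : eta <= s0) (eps0 : 0 < eps).
Context (Hstep : forall x y s, mdist x y <= eps -> `|s| <= eta / 2 ->
  mdist (phi s (phi eta y)) (phi eta x) <= r0).
Context (HstepV : forall x y, mdist x y <= eps ->
  `|V (phi eta x) (phi eta y) - V (phi eta x) (phi eta x)| <= c * (eta / 2)).
Context (UE : uniformly_expansive phi V r0 eta eps).
Implicit Types (C : set X) (F : X -> X).

Let psi := reverse_flow phi.

Definition in_section q x := mdist x q <= r0 /\ V q x = V q q.

Lemma phiK t x : psi t (phi t x) = x.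
Proof. by rewrite /psi /reverse_flow flowNK. Qed.

Lemma section_time_le q x (s t : R) : mdist x q <= r0 -> `|s| <= s0 -> `|t| <= s0 ->
  c * `|s - t| <= `|V q (phi s x) - V q (phi t x)|.
Proof.
case: LS => c0 s00 _ M _ xq; rewrite !ler_norml => /andP[s1 s2] /andP[t1 t2].
have [st|/ltW ts] := leP s t.
  have h := M q x s t xq s1 st t2; rewrite distrC [in leRHS]distrC.
  by rewrite ger0_norm ?subr_ge0 // (le_trans h) // ler_norm.
have := M q x t s xq t1 ts s2 => h.
by rewrite ger0_norm ?subr_ge0 // (le_trans h) // ler_norm.
Qed.

(** The section is centred at the moving point [phi eta x]. By [HstepV] the orbit of [y] is off its
    level by at most [c * (eta / 2)] at time [eta], so growth at rate [c] makes it cross within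
    [eta / 2]. *)
Lemma section_hit x y : mdist x y <= eps ->
  exists u : R, `|u - eta| <= eta / 2 /\ in_section (phi eta x) (phi u y).
Proof.
move=> xy; have ee := eta0; have es := etas.
have e20 : 0 <= eta / 2 by rewrite divr_ge0 // ltW.
have zq : mdist (phi eta y) (phi eta x) <= r0.
  by have := @Hstep x y 0 xy; rewrite normr0 flow0 // => /(_ e20).
have e2s : 0 <= eta / 2 <= s0 by rewrite e20 /=; lra.
have [s sn fs] := section_crossing flow LS zq e2s (HstepV xy).
exists (eta + s); split; first by rewrite addrC addKr.
by rewrite flowD //; split => //; exact: Hstep.
Qed.

(** The hitting times come from choice; their continuity is recovered from [V]. At a common time
    nearby orbits have nearly equal [V q], while a gap between hitting times costs at least [c]
    times that gap. *)
Lemma step_unif (e : R) : 0 < e -> exists2 d : R, 0 < d &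
  forall q y y' u u', `|u - eta| <= eta / 2 -> `|u' - eta| <= eta / 2 ->
    in_section q (phi u y) -> in_section q (phi u' y') -> mdist y y' <= d ->
    mdist (phi u y) (phi u' y') <= e.
Proof.
move=> e0; have [c0 s00 r00 M [_ CV]] := LS.
have e20 : 0 < e / 2 by rewrite divr_gt0.
have [d1 d10 H1] := flow_unif_time cX flow e20.
have [d2 d20 H2] := CV _ (mulr_gt0 c0 d10).
pose m := Num.min d2 (e / 2).
have m0 : 0 < m by rewrite lt_min d20.
have [d d0 H] := flow_unif_space cX flow (2 * eta) m0.
exists d => // q y y' u u' ue u'e [yq yV] [y'q y'V] yy'.
have := eta0; have := etas => es ee.
have bnd v : `|v - eta| <= eta / 2 -> `|v| <= 2 * eta.
  by rewrite !ler_norml => /andP[? ?]; apply/andP; split; lra.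
have := H u' y y' (bnd _ u'e) yy'; rewrite le_min => /andP[h1 h2].
have uu' : `|u' - u| <= s0.
  by move: ue u'e; rewrite !ler_norml => /andP[? ?] /andP[? ?]; apply/andP; split; lra.
have := @section_time_le q (phi u y) (u' - u) 0 yq uu'; rewrite normr0 => /(_ (ltW s00)).
rewrite subr0 flow0 // -flowD // subrKC yV -y'V => h3.
have h4 := H2 q _ _ h1; have h5 : `|u' - u| <= d1.
  by rewrite -(ler_pM2l c0) (le_trans h3).
have h6 := H1 (u' - u) (phi u y) h5.
rewrite -flowD // subrKC metric_sym in h6.
have := metric_triangle (phi u y) (phi u' y) (phi u' y'); lra.
Qed.

Definition history N x y := tracked psi eta eps N x y.

Lemma history_step N x y u u' : history N x y ->
  `|u - eta| <= eta / 2 -> `|u' - eta| <= eta / 2 ->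
  mdist (phi u x) (phi u' y) <= eps -> history N (phi u x) (phi u' y).
Proof.
move=> hN ue u'e d; have ee := eta0; apply: trackedW; split => //; exists (u, u') => /=.
  by move: ue u'e; rewrite !ler_norml => /andP[? ?] /andP[? ?]; split;
    apply/andP; split; lra.
by rewrite !phiK.
Qed.

(** The continuum is moved from section to section until a step makes it larger than [eps]; [F] is
    the composite of these hits. All earlier images being small, the past remains tracked. The
    modulus [d] is fixed before [C], since [select] needs one that serves all continua. *)
Lemma grow N m (e : R) : 0 < e -> exists2 d : R, 0 < d & forall C,
  closed C -> connected C -> C !=set0 ->
  (forall x y, C x -> C y -> mdist x y <= eps) ->
  (forall x y, C x -> C y -> history N x y) ->
  (forall x y, C x -> C y -> tracked phi eta eps m x y) \/
  exists F,
    [/\ forall y, C y -> exists2 v : R, eta / 2 <= v <= m%:R * (2 * eta) & F y = phi v y,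
        (exists q, forall y, C y -> in_section q (F y)),
        (exists x y, [/\ C x, C y & eps < mdist (F x) (F y)]),
        (forall x y, C x -> C y -> mdist (F x) (F y) <= eps -> history N (F x) (F y)) &
        uniform_on C F /\
        (forall x y, C x -> C y -> mdist x y <= d -> mdist (F x) (F y) <= e)].
Proof.
have ee := eta0; elim: m e => [|m IH] e e0.
  by exists 1 => // C _ _ _ dC _; left => x y Cx Cy; split => //; exact: dC.
have [d' d'0 HIH] := IH e e0.
have m0 : 0 < Num.min d' e by rewrite lt_min d'0.
have [d d0 Hd] := step_unif m0.
exists d => // C clC cC [a Ca] dC hC.
pose q := phi eta a.
have exu y : exists u : R, C y -> `|u - eta| <= eta / 2 /\ in_section q (phi u y).
  have [Cy|] := pselect (C y); last by exists 0.
  by have [u uP] := section_hit (dC _ _ Ca Cy); exists u.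
have [u uP] := choice exu.
pose F y := phi (u y) y.
have uF : uniform_on C F.
  move=> e' /step_unif[d1 d10 H1]; exists d1 => // x y Cx Cy.
  have [? ?] := uP _ Cx; have [? ?] := uP _ Cy; exact: (H1 q).
have dF x y : C x -> C y -> mdist x y <= d -> mdist (F x) (F y) <= Num.min d' e.
  move=> Cx Cy; have [? ?] := uP _ Cx; have [? ?] := uP _ Cy; exact: (Hd q).
have hF x y : C x -> C y -> mdist (F x) (F y) <= eps -> history N (F x) (F y).
  move=> Cx Cy; apply: history_step; first exact: hC.
    by case: (uP _ Cx).
  by case: (uP _ Cy).
have uI y : C y -> eta / 2 <= u y <= 2 * eta.
  by move=> /uP[+ _]; rewrite ler_norml => /andP[? ?]; apply/andP; split; lra.
(* If a pair separates now, this [F] is the required map; otherwise the image is again a small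
   continuum and the induction continues from it. *)
have [small|] := pselect (forall x y, C x -> C y -> mdist (F x) (F y) <= eps); last first.
  move=> /existsNP[x /existsNP[y /not_implyP[Cx /not_implyP[Cy /negP]]]].
  rewrite -ltNge => lt; right; exists F; split => //.
  - move=> z Cz; exists (u z) => //; have /andP[-> h] := uI _ Cz => /=.
    have : 0 <= m%:R * (2 * eta) by rewrite mulr_ge0 //; lra.
    by rewrite -[m.+1%:R]natr1 mulrDl mul1r; lra.
  - by exists q => z Cz; case: (uP _ Cz).
  - by exists x, y.
  - by split => // x' y' Cx' Cy' /dF; rewrite le_min => /(_ Cx' Cy') /andP[].
have [clD cD] := uniform_on_image cX clC cC uF.
have [|x' y' [x Cx <-] [y Cy <-]|x' y' [x Cx <-] [y Cy <-]|tD|] := HIH _ clD cD.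
- by exists (F a), a.
- exact: small.
- by apply: hF => //; exact: small.
- left => x y Cx Cy; split; first exact: dC.
  exists (u x, u y); first by split; exact: uI.
  by apply: tD; [exists x|exists y].
move=> [G [Gv [q' Gq] [x' [y' [[x Cx <-] [y Cy <-] lt]]] hG [uG dG]]].
right; exists (G \o F); split.
- move=> z Cz; have [v /andP[v1 v2] E] := Gv _ (imageP F Cz).
  exists (u z + v); last by rewrite /= E flowD.
  have /andP[u1 u2] := uI _ Cz.
  by rewrite -[m.+1%:R]natr1 mulrDl mul1r; apply/andP; split; lra.
- by exists q' => z Cz; exact/Gq/imageP.
- by exists x, y.
- by move=> z w Cz Cw; apply: hG; exact: imageP.
- split.
    move=> e' /uG[d1 d10 H1]; have [d2 d20 H2] := uF _ d10.
    by exists d2 => // z w Cz Cw zw; apply: H1; [exact: imageP|exact: imageP|exact: H2].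
  move=> z w Cz Cw zw; apply: dG; [exact: imageP|exact: imageP|].
  by have := dF _ _ Cz Cw zw; rewrite le_min => /andP[].
Qed.

(** A continuum that has just grown: the size [eps / 4] is what [boundary_bumping] leaves after the
    splitting into daughters. *)
Definition state N C :=
  [/\ closed C, connected C, (exists q, forall y, C y -> in_section q y),
      (forall x y, C x -> C y -> history N x y) &
      exists x y, [/\ C x, C y & eps / 4 <= mdist x y]].

(** Around two points more than [eps] apart, subcontinua of radius [eps / 4] are at least [eps / 2]
    apart, and their own diameters are below [eps], so that they keep the small past. *)
Lemma split_state N C F : closed C -> connected C -> uniform_on C F ->
  (exists q, forall y, C y -> in_section q (F y)) ->
  (exists x y, [/\ C x, C y & eps < mdist (F x) (F y)]) ->
  (forall x y, C x -> C y -> mdist (F x) (F y) <= eps -> history N (F x) (F y)) ->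
  exists C1 C2, [/\ state N C1, state N C2, C1 `<=` F @` C, C2 `<=` F @` C &
    forall x y, C1 x -> C2 y -> eps / 2 <= mdist x y].
Proof.
move=> clC cC uF [q Fq] [x [y [Cx Cy lt]]] hF; have e0 := eps0.
have [clD cD] := uniform_on_image cX clC cC uF.
have sub a b : (F @` C) a -> (F @` C) b -> eps < mdist a b ->
    exists C1, [/\ state N C1, C1 `<=` F @` C & forall z, C1 z -> mdist a z <= eps / 4].
  move=> Da Db ab; have e40 : 0 < eps / 4 by rewrite divr_gt0.
  have eab : eps / 4 <= mdist a b by lra.
  have [E [clE cE Ea EC [z Ez az]]] := boundary_bumping cX clD cD Da Db e40 eab.
  exists E; split; [split => //| |].
  - by exists q => w /EC[[w' Cw' <-] _]; exact: Fq.
  - move=> u v /EC[[u' Cu' <-] /= h1] /EC[[v' Cv' <-] /= h2]; apply: hF => //.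
    have := metric_triangle (F u') a (F v'); rewrite (metric_sym (F u') a); lra.
  - by exists a, z.
  - by move=> w /EC[].
  - by move=> w /EC[].
have [C1 [s1 C1F d1]] := sub _ _ (imageP F Cx) (imageP F Cy) lt.
rewrite metric_sym in lt.
have [C2 [s2 C2F d2]] := sub _ _ (imageP F Cy) (imageP F Cx) lt.
exists C1, C2; split => // z w /d1 h1 /d2 h2.
have := metric_triangle (F y) w (F x); have := metric_triangle w z (F x).
by rewrite (metric_sym z (F x)) (metric_sym w z); lra.
Qed.

Lemma escape : exists N, forall C, state N C ->
  ~ (forall x y, C x -> C y -> tracked phi eta eps N x y).
Proof.
have e40 : 0 < eps / 4 by rewrite divr_gt0.
have [N HN] := UE e40; exists N => C [_ _ [q Cq] hC [x [y [Cx Cy xy]]]] tC.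
have [xq Vx] := Cq _ Cx; have [yq Vy] := Cq _ Cy.
have := HN q x y xq yq; rewrite Vx Vy => /(_ erefl (tC _ _ Cx Cy) (hC _ _ Cx Cy)).
by rewrite ltNge xy.
Qed.

(* Each state splits into two separated states within [N] steps; a small bad set
   meets the past of at most one of them, so [k] splittings dodge any family of
   fewer than [2 ^ k] small sets, in a time only linear in [k]. *)
Lemma select N : (forall C, state N C ->
    ~ (forall x y, C x -> C y -> tracked phi eta eps N x y)) ->
  forall k, exists2 d : R, 0 < d & forall C, state N C ->
    forall (I : finType) (J : pred I) (B : I -> set X), (#|J| < 2 ^ k)%N ->
    (forall i, J i -> forall x y, C x -> C y -> B i x -> B i y -> mdist x y <= d) ->
    exists D, state N D /\ forall z, D z -> exists y, exists2 v : R,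
      k%:R * (eta / 2) <= v <= k%:R * (N%:R * (2 * eta)) &
      [/\ C y, z = phi v y & forall i, J i -> ~ B i y].
Proof.
move=> HN; elim=> [|k [d' d'0 IH]].
  exists 1 => // C sC I J B; rewrite expn0 ltnS leqn0 => /eqP/card0_eq J0 _.
  exists C; split => // z Cz; exists z, 0; first by rewrite !mul0r lexx.
  by split => //; [rewrite flow0|move=> i Ji; have := J0 i; rewrite unfold_in Ji].
(* [d'] keeps the transported bad sets small enough for the induction; [eps / 4] is below the
   separation [eps / 2] of the daughters, so one bad set cannot reach both. *)
have e0 := eps0; have m0 : 0 < Num.min d' (eps / 4) by rewrite lt_min d'0 divr_gt0.
have [d d0 Hd] := grow N N m0.
exists d => // C sC I J B J2 Bd.
have [clC cC Cq hC Cbig] := sC.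
have [|||small|[F [Fv Fq Fbig hF [uF dF]]]] := Hd C clC cC.
- by case: Cbig => x [y [Cx _ _]]; exists x.
- by move=> x y Cx Cy; apply: tracked_dist (hC _ _ Cx Cy).
- exact: hC.
- by have := HN C sC small.
have [C1 [C2 [s1 s2 C1F C2F sep]]] := split_state clC cC uF Fq Fbig hF.
(* Recursion from the daughter [E], with the bad sets in [J'] pushed forward by [F]; the other bad
   sets do not reach [E]. *)
have finish E (J' : pred I) : state N E -> E `<=` F @` C -> (#|J'| < 2 ^ k)%N ->
    (forall i, J' i -> J i) ->
    (forall i, J i -> ~~ J' i -> forall y, C y -> B i y -> ~ E (F y)) ->
    exists D, state N D /\ forall z, D z -> exists y, exists2 v : R,
      k.+1%:R * (eta / 2) <= v <= k.+1%:R * (N%:R * (2 * eta)) &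
      [/\ C y, z = phi v y & forall i, J i -> ~ B i y].
  move=> sE EF J'2 J'J J'E.
  have [i J'i z w Ez Ew [x [Cx Bx] xz] [y [Cy By] yw]|D [sD DP]] :=
    IH E sE I J' (fun i => F @` (C `&` B i)) J'2.
    rewrite -xz -yw; have := dF _ _ Cx Cy (Bd _ (J'J _ J'i) _ _ Cx Cy Bx By).
    by rewrite le_min => /andP[].
  exists D; split => // z Dz; have [w [v /andP[v1 v2] [Ew zE nB]]] := DP _ Dz.
  have [y Cy yw] := EF _ Ew; have [v' /andP[v'1 v'2] FE] := Fv _ Cy.
  exists y, (v' + v).
    by rewrite -[k.+1%:R]natr1 !mulrDl !mul1r; apply/andP; split; lra.
  split => //; first by rewrite zE -yw FE flowD.
  move=> i Ji By; have [J'i|nJ'i] := boolP (J' i).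
    by apply: (nB i J'i); exists y.
  by apply: (J'E i Ji nJ'i y Cy By); rewrite yw.
(* The bad sets reaching [C1]; they miss [C2]. Either they or the remaining ones number fewer than
   [2 ^ k]: in the first case [C1] is kept, in the second [C2]. *)
pose P1 i := `[< exists y, [/\ C y, B i y & C1 (F y)] >].
have cards : (#|[predI J & P1]| + #|[predD J & P1]| < 2 ^ k + 2 ^ k)%N.
  by rewrite cardID addnn -mul2n -expnS.
have [lt|ge] := ltnP #|[predI J & P1]| (2 ^ k).
  apply: (finish C1 _ s1 C1F lt) => [i /andP[]//|i Ji /negP nP y Cy By C1y].
  by apply: nP; apply/andP; split => //; apply/asboolP; exists y.
apply: (finish C2 [predD J & P1] s2 C2F) => [|i /andP[]//|i Ji /negP nP].
  by rewrite -(ltn_add2l (2 ^ k)); apply: leq_ltn_trans cards; rewrite leq_add2r.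
have /asboolP[y [Cy By C1y]] : P1 i.
  by apply: contrapT => /negP nPi; apply: nP; apply/andP.
move=> y' Cy' By' C2y'; have := sep _ _ C1y C2y'.
have := dF _ _ Cy Cy' (Bd _ Ji _ _ Cy Cy' By By').
by rewrite le_min => /andP[]; lra.
Qed.

(** Flowing back from [p] brings [phi (v - w) x] close to [y]. As [x] and [y] have the same value of
    [V q], growth along orbits forces [v - w] to be small, hence [x] close to [y]. *)
Lemma close_visits (T d : R) : 0 < d -> exists2 r : R, 0 < r &
  forall q p x y (v w : R), in_section q x -> in_section q y -> `|v| <= T -> `|w| <= T ->
    `|v - w| <= s0 -> mdist (phi v x) p <= r -> mdist (phi w y) p <= r ->
    mdist x y <= d.
Proof.
move=> d0; have [c0 s00 r00 M [_ CV]] := LS.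
have d20 : 0 < d / 2 by rewrite divr_gt0.
have [d1 d10 H1] := flow_unif_time cX flow d20.
have [d2 d20' H2] := CV _ (mulr_gt0 c0 d10).
have m0 : 0 < Num.min d2 (d / 2) by rewrite lt_min d20'.
have [r r0' H] := flow_unif_space cX flow T m0.
exists (r / 2); first by rewrite divr_gt0.
move=> q p x y v w [xq Vx] [yq Vy] vT wT vw xp yp.
have xy : mdist (phi v x) (phi w y) <= r.
  by have := metric_triangle (phi v x) p (phi w y); rewrite (metric_sym p); lra.
have NwT : `|- w| <= T by rewrite normrN.
have := H _ _ _ NwT xy; rewrite -!flowD // subrr flow0 // le_min => /andP[h1 h2].
have := @section_time_le q x (v - w) 0 xq vw; rewrite normr0 => /(_ (ltW s00)).
rewrite subr0 flow0 // Vx -Vy => h3.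
have h5 : `|v - w| <= d1 by rewrite -(ler_pM2l c0) (le_trans h3) // H2.
have h6 := H1 _ x h5.
have := metric_triangle x (phi (v - w) x) y; rewrite (metric_sym x (phi _ _)); lra.
Qed.

(** One bad set is attached to each centre in [ps] and each time window of length [s0]. The [k]
    generations last at most [k%:R * T], which [k * L] windows cover, so it suffices that [2 ^ k]
    exceeds [size ps * (k * L)]. *)
Lemma avoid N (ps : seq X) : (forall C, state N C ->
    ~ (forall x y, C x -> C y -> tracked phi eta eps N x y)) ->
  exists2 r : R, 0 < r & forall C, state N C -> exists D, state N D /\
    forall z, D z -> exists y, exists2 v : R, eta / 2 <= v &
      [/\ C y, z = phi v y &
          forall w, 0 <= w <= v -> forall p, p \in ps -> r < mdist (phi w y) p].
Proof.
move=> HN; have [c0 s00 r00 M _] := LS; have ee := eta0.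
pose T := N%:R * (2 * eta).
have T0 : 0 <= T by rewrite mulr_ge0 // mulr_ge0 // ltW.
have [L TL] : exists L : nat, T < L%:R * s0.
  exists (Num.truncn (T / s0)).+1; by rewrite -ltr_pdivrMr //; exact: truncnS_gt.
have [k k0 kL] : exists2 k, (0 < k)%N & (size ps * (k * L) < 2 ^ k)%N.
  (* The inequality is [a * k < 2 ^ k]: with [k] twice [a.+1], one factor [2 ^ a.+1] bounds [k] and
     the other exceeds [a]. *)
  pose a := (size ps * L)%N; exists (a.+1 + a.+1)%N => //.
  have h : (a < 2 ^ a)%N by exact: ltn_expl.
  have le : (a.+1 + a.+1 <= 2 * 2 ^ a)%N by rewrite addnn -mul2n leq_mul2l h.
  rewrite mulnCA -/a expnD expnS (leq_ltn_trans (leq_mul le (leqnn a))) //.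
  rewrite ltn_pmul2l ?muln_gt0 ?expn_gt0 // (leq_trans h) //.
  by rewrite leq_pmull.
have [d d0 Hd] := select HN k.
have [r r0' Hr] := close_visits (k%:R * T) d0.
exists r => // C sC.
pose J : pred ('I_(size ps) * 'I_(k * L)) := xpredT.
pose B (i : 'I_(size ps) * 'I_(k * L)) : set X := [set y | exists2 v : R,
  0 <= v <= k%:R * T /\ i.2%:R * s0 <= v <= i.2.+1%:R * s0 &
  exists2 p, onth ps i.1 = Some p & mdist (phi v y) p <= r].
have [||D [sD DP]] := Hd C sC _ J B.
- by rewrite cardT -cardE card_prod !card_ord.
- move=> [i l] _ x y Cx Cy [v [/andP[v0 v1] /andP[/= v2 v3]] [p ip xp]].
  move=> [w [/andP[w0 w1] /andP[/= w2 w3]] [p' ip' yp]].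
  have [_ _ [q Cq] _ _] := sC.
  move: ip'; rewrite ip => -[pp']; rewrite -pp' in yp.
  apply: (Hr q p x y v w) => //; [exact: Cq|exact: Cq|by rewrite ger0_norm| |].
    by rewrite ger0_norm.
  rewrite -[l.+1%:R]natr1 mulrDl mul1r in v3 w3.
  by rewrite ler_norml; apply/andP; split; lra.
exists D; split => // z Dz; have [y [v /andP[v1 v2] [Cy zE nB]]] := DP _ Dz.
exists y, v.
  by apply: le_trans v1; rewrite ler_peMl ?ler1n // divr_ge0 // ltW.
split => // w /andP[w0 wv] p pps; rewrite ltNge; apply/negP => le.
have ip : (index p ps < size ps)%N by rewrite index_mem.
have wT : w <= k%:R * T by exact: le_trans v2.
have /andP[l1 l2] : (Num.truncn (w / s0))%:R <= w / s0 < (Num.truncn (w / s0)).+1%:R.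
  by apply: truncn_itv; rewrite divr_ge0 // ltW.
set l := Num.truncn _ in l1 l2.
rewrite ler_pdivlMr // in l1; rewrite ltr_pdivrMr // in l2.
have lkL : (l < k * L)%N.
  rewrite -(ltr_nat R) natrM -(ltr_pM2r s00) (le_lt_trans l1) // (le_lt_trans wT) //.
  by rewrite -mulrA ltr_pM2l // ltr0n.
apply: (nB (Ordinal ip, Ordinal lkL) isT); exists w; first by rewrite w0 wT /= l1 ltW.
by exists p => //=; rewrite onthE (nth_map p) // nth_index.
Qed.

(** The radius given by [avoid] serves every state, so iteration produces past segments of any
    length that avoid the same balls. *)
Lemma orbit_avoiding N (ps : seq X) : (forall C, state N C ->
    ~ (forall x y, C x -> C y -> tracked phi eta eps N x y)) ->
  forall C, state N C -> exists2 r : R, 0 < r &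
    exists x, forall t p, p \in ps -> r <= mdist (phi t x) p.
Proof.
move=> HN C sC; have [r r0' Hr] := avoid ps HN; exists r => //.
have ee : 0 < eta / 2 by rewrite divr_gt0.
have past j : exists D, state N D /\ forall z, D z -> exists y, exists2 v : R,
    j%:R * (eta / 2) <= v & z = phi v y /\
    forall w, 0 <= w <= v -> forall p, p \in ps -> r <= mdist (phi w y) p.
  elim: j => [|j [D [sD DP]]].
    have [D [sD DP]] := Hr C sC; exists D; split => // z /DP[y [v v0 [_ zE yP]]].
    exists y, v; first by rewrite mul0r (le_trans (ltW ee)).
    by split => // w wv p pps; exact/ltW/yP.
  have [E [sE EP]] := Hr D sD; exists E; split => // z /EP[y [v v0 [Dy zE yP]]].
  have [y' [v' v'0 [yE y'P]]] := DP _ Dy; exists y', (v' + v).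
    by rewrite -natr1 mulrDl mul1r lerD.
  split; first by rewrite zE yE flowD.
  move=> w /andP[w0 wv] p pps; have [wv'|/ltW v'w] := leP w v'.
    by apply: y'P => //; rewrite w0.
  rewrite -(subrKC v' w) flowD // -yE; apply/ltW/yP => //.
  by apply/andP; split; lra.
(* The past segment has length at least [n%:R * (eta / 2)]; recentring it at time [n%:R * (eta / 4)]
   leaves this much time on both sides. *)
pose F n := [set x | forall t p, `|t| <= n%:R * (eta / 4) -> p \in ps ->
  r <= mdist (phi t x) p].
have [n|n x Fx|n|x _ xF] := compact_nested (F := F) cX.
- rewrite (_ : F n = \bigcap_(tp in [set tp : R * X | `|tp.1| <= n%:R * (eta / 4) /\
      tp.2 \in ps]) [set x | r <= mdist (phi tp.1 x) tp.2]).
    apply: closed_bigI => -[t p] _ /=; apply: closed_le_fun; first exact: cst_continuous.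
    by apply: continuous_mdist; [exact: continuous_flow_space|move=> ?; exact: cvg_cst].
  apply/seteqP; split => x Fx.
    by move=> [t p] [/= h1 h2]; exact: Fx.
  by move=> t p h1 h2; apply: (Fx (t, p)).
- move=> t p tn; apply: Fx; apply: (le_trans tn).
  by rewrite ler_wpM2r ?ler_nat // divr_ge0 // ltW.
- have [D [[_ _ _ _ [z [_ [Dz _ _]]]] DP]] := past n.
  have [y [v vn [_ yP]]] := DP _ Dz.
  exists (phi (n%:R * (eta / 4)) y); split => // t p.
  rewrite ler_norml => /andP[t1 t2] pps; rewrite -flowD //; apply: yP => //.
  by apply/andP; split; lra.
exists x => t p pps; have e40 : 0 < eta / 4 by rewrite divr_gt0.
apply: (xF (Num.truncn (`|t| / (eta / 4))).+1) => //.
by rewrite -ler_pdivrMr //; exact/ltW/truncnS_gt.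
Qed.

Lemma continuum_orbit_avoiding : exists N, forall C, closed C -> connected C ->
  (forall x y, C x -> C y -> mdist x y <= eps) ->
  (forall x y, C x -> C y -> history N x y) ->
  (exists a b n, [/\ C a, C b & ~ tracked phi eta eps n a b]) ->
  forall ps : seq X, exists2 r : R, 0 < r &
    exists x, forall t p, p \in ps -> r <= mdist (phi t x) p.
Proof.
have [N HN] := escape; exists N => C clC cC dC hC [a [b [n [Ca Cb nt]]]] ps.
(* The first growth takes up to [n] steps, without a uniform bound; from the first state on, [N]
   steps are enough. *)
have [d d0 Hd] := grow N n ltr01.
have [|//|//|tC|[F [_ Fq Fbig hF [uF _]]]] := Hd C clC cC; first by exists a.
  by exfalso; apply: nt; exact: tC.
have [C1 [_ [s1 _ _ _ _]]] := split_state clC cC uF Fq Fbig hF.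
exact: (orbit_avoiding ps HN s1).
Qed.


End Engine.

(** * Minimal sets and total disconnectedness of sections *)

Section FlowDimension.
Context {R : realType} {X : metricType R} (cX : compact [set: X]).
Context (phi : R -> X -> X) (flow : is_flow phi).
Implicit Types (A B C K L P : set X) (x y z q : X).

(** Zorn's lemma is applied to the complements: open invariant sets that do not cover [L].
    Compactness of [L] shows that the union of a chain does not cover it either. *)
Lemma exists_minimal L : closed L -> L !=set0 ->
  (forall t x, L x -> L (phi t x)) -> exists2 K, minimal_set phi K & K `<=` L.
Proof.
move=> clL L0 Linv.
pose P A := [/\ open A, (forall t x, A x -> A (phi t x)) & ~ (L `<=` A)].
have [F FP Ftot|A [[oA Ainv nLA] Amax]] := @Zorn_bigcup X P.
  split; first by apply: bigcup_open => A /FP[].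
    by move=> t x [A FA Ax]; exists A => //; have [_ + _] := FP _ FA; apply.
  move=> LF; have [F0|/set0P[A0 FA0]] := eqVneq F set0.
    by case: L0 => x /LF; rewrite F0 bigcup_set0.
  have [||_ [A FA <-]|x Lx xF] :=
      compact_directed (D := [set ~` A | A in F]) (compactT_closed cX clL).
  - by exists (~` A0); exists A0.
  - move=> _ _ [A FA <-] [B FB <-]; have [AB|BA] := Ftot _ _ FA FB.
      by exists (~` B); [exists B|move=> x nBx; split => // /AB].
    by exists (~` A); [exists A|move=> x nAx; split => // /BA].
  - have [oA _ nLA] := FP _ FA; split; first exact: open_closedC.
    by have /existsNP[x /not_implyP[Lx nAx]] := nLA; exists x.
  have [A FA Ax] := LF _ Lx.
  by apply: (xF (~` A)) => //; exists A.
have inv_image K : (forall t x, K x -> K (phi t x)) -> invariant_set phi K.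
  move=> Kinv t; apply/seteqP; split => [_ [x Kx <-]|x Kx]; first exact: Kinv.
  by exists (phi (- t) x); [exact: Kinv|rewrite flowKN].
exists (L `&` ~` A); last by move=> x [].
split.
- by have /existsNP[x /not_implyP[Lx nAx]] := nLA; exists x.
- apply: compactT_closed => //; apply: closedI => //; exact: open_closedC.
- apply: inv_image => t x [Lx nAx]; split; first exact: Linv.
  by move=> /(Ainv (- t)); rewrite flowNK.
move=> K KLA [k Kk] cK invK.
have Kinv t x : K x -> K (phi t x) by move=> Kx; rewrite -(invK t); exists x.
apply/seteqP; split => // x [Lx nAx]; apply: contrapT => nKx.
have AK : A `<` ~` K.
  by split => [y Ay Ky|/(_ x nKx)/nAx//]; have [_] := KLA _ Ky; apply.
apply: (Amax _ AK); split.
- by apply: closed_openC; exact: compactX_closed.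
- by move=> t y nKy /(Kinv (- t)); rewrite flowNK.
- by move=> /(_ k); apply => //; have [] := KLA _ Kk.
Qed.

(** The points whose orbits stay at distance [r] from all chosen points form a closed invariant set;
    a minimal set inside it would contain its own chosen point. *)
Lemma finite_minimal_net : finite_set [set K | minimal_set phi K] ->
  exists ps : seq X, forall (r : R) x, 0 < r ->
    ~ (forall t p, p \in ps -> r <= mdist (phi t x) p).
Proof.
move=> /finite_seqP[s sP].
(* The option makes the choice total: the empty set gets [None], which [pmap] drops. *)
have exp (K : set X) : exists p : option X,
    K !=set0 -> if p is Some p' then K p' else False.
  have [[p Kp]|nK] := pselect (K !=set0); first by exists (Some p).
  by exists None.
have [f fP] := choice exp.
exists (pmap f s) => r x r0 H.
pose L := [set y | forall t p, p \in pmap f s -> r <= mdist (phi t y) p].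
have clL : closed L.
  rewrite (_ : L = \bigcap_(tp in [set tp : R * X | tp.2 \in pmap f s])
      [set y | r <= mdist (phi tp.1 y) tp.2]).
    apply: closed_bigI => -[t p] _ /=; apply: closed_le_fun; first exact: cst_continuous.
    by apply: continuous_mdist; [exact: continuous_flow_space|move=> ?; exact: cvg_cst].
  apply/seteqP; split => y Ly; first by move=> [t p] /= pps; exact: Ly.
  by move=> t p pps; apply: (Ly (t, p)).
have [||K mK KL] := exists_minimal clL.
- by exists x.
- by move=> t y Ly u p pps; rewrite -flowD //; exact: Ly.
have [K0 _ _ _] := mK.
have : [set K | minimal_set phi K] K by [].
rewrite sP /= => Ks; have := fP K K0; case fK : (f K) => [p|//] Kp.
have /(KL _ Kp 0) : p \in pmap f s by rewrite mem_pmap -fK map_f.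
by rewrite flow0 // mdistxx leNgt r0.
Qed.

Lemma tracked_near (eta eps : R) N : 0 < eta -> 0 < eps -> exists2 d : R, 0 < d &
  forall x y, mdist x y <= d -> tracked phi eta eps N x y.
Proof.
move=> eta0 eps0; elim: N => [|N [d' d'0 IH]]; first by exists eps.
have [d d0 H] := flow_unif_space cX flow eta d'0.
exists (Num.min d eps); first by rewrite lt_min d0.
move=> x y; rewrite le_min => /andP[h1 h2]; split => //; exists (eta, eta) => /=.
  by split; apply/andP; split; lra.
by apply: IH; apply: H => //; rewrite ger0_norm // ltW.
Qed.

End FlowDimension.

(** * Total disconnectedness of the sections *)

Section SectionsZeroDim.
Context {R : realType} {X : metricType R} (cX : compact [set: X]).
Context (phi : R -> X -> X) (flow : is_flow phi) (expa : expansive_flow phi).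
Context (V : X -> X -> R) (c s0 r0 : R) (LS : local_sections phi V c s0 r0).
Implicit Types (A B C K L P : set X) (x y z q : X).

Lemma closed_section q : closed [set x | in_section V r0 q x].
Proof.
have cV : continuous (V q).
  move=> x; apply: (@continuous_comp _ _ _ (fun x => (q, x))
    (fun z : X * X => V z.1 z.2)).
    have cq : continuous (fun _ : X => q) by move=> ?; exact: cvg_cst.
    have ci : continuous (fun x : X => x) by move=> ?; exact: cvg_id.
    exact: (cvg_pair (cq x) (ci x)).
  exact: (local_sections_continuous LS).
have cqq : continuous (fun _ : X => V q q) by move=> ?; exact: cvg_cst.
rewrite (_ : mkset _ = [set x | mdist x q <= r0] `&` [set x | V q x <= V q q] `&`
   [set x | V q q <= V q x]).
  apply: closedI; first apply: closedI.
  - apply: closed_le_fun; last exact: cst_continuous.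
    by apply: continuous_mdist; [move=> ?; exact: cvg_id|exact: cst_continuous].
  - exact: closed_le_fun.
  - exact: closed_le_fun.
apply/seteqP; split => x; first by move=> [h1 h2]; split; [split|] => //=; rewrite h2.
by move=> [[h1 h2] h3]; split => //; apply/eqP; rewrite eq_le h2 h3.
Qed.

Lemma section_totally_disconnected (ps : seq X) :
  (forall (r : R) x, 0 < r -> ~ (forall t p, p \in ps -> r <= mdist (phi t x) p)) ->
  forall q, totally_disconnected [set x | in_section V r0 q x].
Proof.
move=> net q; have [c0 s00 r00 M [Cq CV]] := LS.
have [delta delta0 expaP] := expa s00.
(* [w] bounds the motion during one step. The bounds in [delta] give [eps + 2 * w <= delta] for
   expansivity; the two halves of [r0], in [w] and in [m], keep a corrected hit within [r0] of its
   centre. *)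
pose w := Num.min (delta / 4) (r0 / 2).
have w0 : 0 < w by rewrite lt_min !divr_gt0.
have wd : w <= delta / 4 by rewrite ge_min lexx.
have wr : w <= r0 / 2 by rewrite ge_min lexx orbT.
have [d1 d10 H1] := flow_unif_time cX flow w0.
pose eta := Num.min (d1 / 2) s0.
have eta0 : 0 < eta by rewrite lt_min s00 divr_gt0.
have etas : eta <= s0 by rewrite ge_min lexx orbT.
have eta1 : eta <= d1 / 2 by rewrite ge_min lexx.
have ce : 0 < c * (eta / 2) by rewrite mulr_gt0 // divr_gt0.
have [d2 d20 H2] := CV _ ce.
pose m := Num.min d2 (r0 / 2).
have m0 : 0 < m by rewrite lt_min d20 divr_gt0.
have md2 : m <= d2 by rewrite ge_min lexx.
have mr : m <= r0 / 2 by rewrite ge_min lexx orbT.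
have [d3 d30 H3] := flow_unif_space cX flow eta m0.
pose eps := Num.min d3 (delta / 2).
have eps0 : 0 < eps by rewrite lt_min d30 divr_gt0.
have epsd : eps <= d3 by rewrite ge_min lexx.
have epsdel : eps <= delta / 2 by rewrite ge_min lexx orbT.
clearbody w eta m eps.
pose psi := reverse_flow phi.
have flow' : is_flow psi by exact: is_flow_reverse.
have LS' : local_sections psi (fun q x => - V q x) c s0 r0.
  exact: local_sections_reverse.
have wP t z : `|t| <= 2 * eta -> mdist (phi t z) z <= w.
  by move=> te; apply: H1; lra.
have ew : eps + 2 * w <= delta by lra.
have UE : uniformly_expansive phi V r0 eta eps.
  exact: (uniform_expansivity cX flow LS eta0 wP ew).
have UE' : uniformly_expansive psi (fun q x => - V q x) r0 eta eps.
  move=> e /UE[N HN]; exists N => q' x y h1 h2 /oppr_inj h3 h4.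
  by rewrite /psi reverse_flowK => h5; apply: (HN q').
have mH t x y : `|t| <= eta -> mdist x y <= eps -> mdist (phi t y) (phi t x) <= m.
  by move=> te xy; apply: H3 => //; rewrite metric_sym; lra.
have stepP t s x y : `|t| <= eta -> mdist x y <= eps -> `|s| <= eta / 2 ->
    mdist (phi s (phi t y)) (phi t x) <= r0.
  move=> te xy se; have h1 := mH _ _ _ te xy.
  have h2 : mdist (phi s (phi t y)) (phi t y) <= w by apply: wP; lra.
  by have := metric_triangle (phi s (phi t y)) (phi t y) (phi t x); lra.
have stepV t x y : `|t| <= eta -> mdist x y <= eps ->
    `|V (phi t x) (phi t y) - V (phi t x) (phi t x)| <= c * (eta / 2).
  by move=> te xy; apply: H2; have := mH _ _ _ te xy; lra.
have ee : `|eta| <= eta by rewrite ger0_norm // ltW.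
have Nee : `|- eta| <= eta by rewrite normrN.
have [N1 HN1] := continuum_orbit_avoiding cX flow LS eta0 etas eps0
  (fun x y s => @stepP eta s x y ee) (fun x y => @stepV eta x y ee) UE.
have [N2 HN2] : exists N, forall C, closed C -> connected C ->
  (forall x y, C x -> C y -> mdist x y <= eps) ->
  (forall x y, C x -> C y -> history psi eta eps N x y) ->
  (exists a b n, [/\ C a, C b & ~ tracked psi eta eps n a b]) ->
  forall ps : seq X, exists2 r : R, 0 < r &
    exists x, forall t p, p \in ps -> r <= mdist (psi t x) p.
  apply: (continuum_orbit_avoiding cX flow' LS' eta0 etas eps0) UE'.
    by move=> x y s xy se; apply: stepP => //; rewrite normrN.
  by move=> x y xy; rewrite -opprD normrN; exact: stepV.
(* The directions cross: [N2] steps along [phi] are the past required for growth under [psi], and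
   [N1] steps along [psi] the past required for growth under [phi]. *)
have [d4 d40 H4] := tracked_near cX flow N2 eta0 eps0.
have [d5 d50 H5] := tracked_near cX flow' N1 eta0 eps0.
pose S := [set x | in_section V r0 q x].
have clS : closed S by exact: closed_section.
move=> x Sx; apply/seteqP; split => [y Sxy|_ ->]; last exact: connected_component_refl.
apply: contrapT => yx.
have xy0 : 0 < mdist x y by rewrite mdist_gt0; apply/eqP => E; apply: yx; rewrite E.
pose r := Num.min (mdist x y) (Num.min d4 d5 / 2).
have rr : 0 < r by rewrite lt_min xy0 divr_gt0 // lt_min d40.
have rxy : r <= mdist x y by rewrite ge_min lexx.
have rd : r <= Num.min d4 d5 / 2 by rewrite ge_min lexx orbT.
have rd4 : 2 * r <= d4.
  have : Num.min d4 d5 <= d4 by rewrite ge_min lexx.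
  by lra.
have rd5 : 2 * r <= d5.
  have : Num.min d4 d5 <= d5 by rewrite ge_min lexx orbT.
  by lra.
have clC := @component_closed _ S x clS.
have cC := @component_connected _ S x.
have Cx := connected_component_refl Sx.
have [D [clD cD Dx DC [y' Dy' ry']]] := boundary_bumping cX clC cC Cx Sxy rr rxy.
have dD z z' : D z -> D z' -> mdist z z' <= 2 * r.
  move=> /DC[_ /= h1] /DC[_ /= h2]; have := metric_triangle z x z'.
  by rewrite (metric_sym z x); lra.
have t4 z z' : D z -> D z' -> tracked phi eta eps N2 z z'.
  by move=> Dz Dz'; apply: H4; rewrite (le_trans (dD _ _ Dz Dz')).
have t5 z z' : D z -> D z' -> tracked psi eta eps N1 z z'.
  by move=> Dz Dz'; apply: H5; rewrite (le_trans (dD _ _ Dz Dz')).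
have Deps z z' : D z -> D z' -> mdist z z' <= eps.
  by move=> Dz Dz'; exact: tracked_dist (t4 _ _ Dz Dz').
have DS : D `<=` S by move=> z /DC[/connected_component_sub].
have xy'0 : 0 < mdist x y' by exact: lt_le_trans ry'.
(* Distinct points of one section separate in some direction of time; this decides between [HN1] and
   [HN2]. *)
have [n nt] : exists n, ~ tracked phi eta eps n x y' \/ ~ tracked psi eta eps n x y'.
  have [N HN] := UE _ xy'0; exists N.
  apply: contrapT => /not_orP[/contrapT h1 /contrapT h2].
  have [xq Vx] := Sx; have [yq Vy] := DS _ Dy'.
  by have := HN q x y' xq yq; rewrite Vx Vy ltxx => /(_ erefl h1 h2).
case: nt => nt.
  have [|r' r'0 [z zP]] := HN1 D clD cD Deps t5 _ ps; first by exists x, y', n.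
  exact: (net r' z r'0).
have [||r' r'0 [z zP]] := HN2 D clD cD Deps _ _ ps.
- by move=> z z' Dz Dz'; rewrite /history /psi reverse_flowK; exact: t4.
- by exists x, y', n.
apply: (net r' z r'0) => t p pps.
by have := zP (- t) p pps; rewrite /psi /reverse_flow opprK.
Qed.

End SectionsZeroDim.

(** * Flow boxes *)

Section FlowBoxes.
Context {R : realType} {X : metricType R} (cX : compact [set: X]).
Context (phi : R -> X -> X) (flow : is_flow phi).
Context (V : X -> X -> R) (c s0 r0 : R) (LS : local_sections phi V c s0 r0).
Implicit Types (A B C K L P O : set X) (x y z q : X).

Lemma totally_disconnected_flow P (b : R) :
  totally_disconnected P -> totally_disconnected (phi b @` P).
Proof.
move=> tP _ [y Py <-]; apply/seteqP; split => [z [C [Cy CP cC] Cz]|_ ->]; last first.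
  exact/connected_component_refl/imageP.
have CP' : phi (- b) @` C `<=` P.
  by move=> _ [u /CP[v Pv <-] <-]; rewrite flowNK.
have cC' : connected (phi (- b) @` C).
  apply: connected_continuous_connected => //.
  by apply: continuous_subspaceT; exact: continuous_flow_space.
have : connected_component P y (phi (- b) z).
  exists (phi (- b) @` C); last by exists z.
  by split => //; exists (phi b y) => //; rewrite flowNK.
by rewrite tP // => /= <-; rewrite flowKN.
Qed.

Lemma totally_disconnected_sub P L : P `<=` L -> totally_disconnected L ->
  totally_disconnected P.
Proof.
move=> PL tL x Px; apply/seteqP; split => [y [C [Cx CP cC] Cy]|_ ->]; last first.
  exact: connected_component_refl.
rewrite -(tL x (PL _ Px)); exists C => //; split => //.
exact: subset_trans PL.
Qed.

(** The box sweeps a relatively clopen piece [P] of the section through times [|t| < b]. Being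
    clopen, [P] contributes no lateral boundary; only the end faces remain, and they are totally
    disconnected like [P]. *)
Lemma flow_box x O : open O -> O x ->
  totally_disconnected [set y | in_section V r0 x y] ->
  exists B L, [/\ open B, B x, B `<=` O &
     [/\ closed L, zero_dim_in L & closure B `\` B `<=` L]].
Proof.
move=> oO Ox tdS; have [c0 s00 r00 M [Cq CV]] := LS.
pose S := [set y | in_section V r0 x y].
have clS : closed S by exact: (closed_section LS).
have /mdist_nbhsP[e e0 eO] : nbhs x O by exact: open_nbhs_nbhs.
have e20 : 0 < e / 2 by rewrite divr_gt0.
have [b b0 Hb] := flow_unif_time cX flow e20.
pose u := Num.min (e / 2) (r0 / 4).
have u0 : 0 < u by rewrite lt_min e20 divr_gt0.
have Sx : S x by split => //; rewrite mdistxx ltW.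
have [|P [PSU Px clP clSP]] := component_clopen cX clS (@open_mdist_lt _ _ x u) Sx.
  by rewrite tdS // => _ -> /=; rewrite mdistxx.
pose G := ~` (S `\` P).
have oG : open G by exact: closed_openC.
have GSP z : G z -> S z -> P z by move=> Gz Sz; apply: contrapT => nPz; apply: Gz.
have PG : P `<=` G by move=> z Pz [].
have PS : P `<=` S by move=> z /PSU[].
have Pu z : P z -> mdist x z < u by move=> /PSU[].
have ue : u <= e / 2 by rewrite ge_min lexx.
have ur : u <= r0 / 4 by rewrite ge_min lexx orbT.
clearbody u.
pose B := [set z | exists2 t, `|t| < b & P (phi t z)].
have clPb t : closed (phi t @` P).
  apply: compactX_closed; apply: continuous_compact; last exact: compactT_closed.
  by apply: continuous_subspaceT; exact: continuous_flow_space.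
have zPb t : zero_dim_in (phi t @` P).
  apply: totally_disconnected_zero_dim => //; apply: totally_disconnected_flow.
  exact: totally_disconnected_sub tdS.
exists B, (phi b @` P `|` phi (- b) @` P); split.
(* A point near [z] passes near [phi t z] and crosses the section within [k] of time [t], at a point
   of [S] in [G], hence of [P]. The bound of [k] by the slack [b - |t|] keeps the crossing time
   below [b]. *)
- rewrite openE => z [t tb Pz]; apply/mdist_nbhsP.
  pose y := phi t z.
  have /mdist_nbhsP[g g0 gG] : nbhs y G by apply: open_nbhs_nbhs; split => //; exact: PG.
  have m0 : 0 < Num.min (g / 2) (r0 / 2) by rewrite lt_min !divr_gt0.
  have [h h0 Hh] := flow_unif_time cX flow m0.
  pose k := Num.min (Num.min h s0) ((b - `|t|) / 2).
  have k0 : 0 < k by rewrite !lt_min h0 s00 divr_gt0 // subr_gt0.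
  have kh : k <= h by rewrite !ge_min lexx.
  have ks : k <= s0 by rewrite !ge_min lexx orbT.
  have kb : k <= (b - `|t|) / 2 by rewrite ge_min lexx orbT.
  clearbody k.
  have [d d0 Hd] := CV _ (mulr_gt0 c0 k0).
  have m'0 : 0 < Num.min (Num.min (g / 4) (r0 / 4)) d by rewrite !lt_min !divr_gt0.
  have [a a0 Ha] := flow_unif_space cX flow `|t| m'0.
  exists a => // z' zz'.
  have := Ha t z z' (lexx _) (ltW zz').
  rewrite !le_min => /andP[/andP[h1 h2] h3].
  have yx := Pu _ Pz; have [_ VyE] := PS _ Pz.
  have y'x : mdist (phi t z') x <= r0.
    have := metric_triangle (phi t z') (phi t z) x.
    by rewrite (metric_sym (phi t z') (phi t z)) (metric_sym (phi t z) x); lra.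
  have k0s : 0 <= k <= s0 by rewrite ltW.
  have [|s sk Vs] := section_crossing flow LS y'x k0s.
    by rewrite -VyE distrC; exact: Hd.
  have sh : `|s| <= h by exact: le_trans kh.
  have := Hh s (phi t z') sh; rewrite le_min => /andP[h4 h5].
  have tri := metric_triangle (phi s (phi t z')) (phi t z') (phi t z).
  rewrite (metric_sym (phi t z') (phi t z)) in tri.
  have Ps : P (phi s (phi t z')).
    apply: GSP.
      by apply: gG; rewrite /y metric_sym; lra.
    split => //.
    have := metric_triangle (phi s (phi t z')) (phi t z) x.
    by rewrite (metric_sym (phi t z) x); lra.
  exists (t + s); last by rewrite flowD.
  by rewrite (le_lt_trans (ler_normD _ _)) //; lra.
- by exists 0; rewrite ?normr0 // flow0.
- move=> z [t tb Pz]; apply: eO; have := Pu _ Pz.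
  have := Hb (- t) (phi t z); rewrite normrN flowNK // => /(_ (ltW tb)).
  by have := metric_triangle x (phi t z) z; rewrite (metric_sym z); lra.
split; first by apply: closedU.
  exact: zero_dim_inU.
move=> z [clz nBz].
(* With the end times included the sweep is closed, so it contains the closure of [B]; a point of it
   outside [B] must use [|t| = b]. *)
have clK : closed [set z | exists2 t, `[- b, b]%classic t & P (phi t z)].
  apply: (@closed_projection R X `[- b, b]%classic [set w | P (phi w.1 w.2)]).
    exact: segment_compact.
  have cphi : continuous (fun w : R * X => phi w.1 w.2) by case: flow.
  rewrite (_ : mkset _ = (fun w : R * X => phi w.1 w.2) @^-1` P) //.
  by apply: closed_comp => // w _; exact: cphi.
have [t tb Pt] : [set z | exists2 t, `[- b, b]%classic t & P (phi t z)] z.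
  apply: clK; apply: closureS clz => w [t tb Pw]; exists t => //=.
  by rewrite in_itv /= -ler_norml ltW.
rewrite /= in_itv /= -ler_norml le_eqVlt in tb.
case/orP: tb => [/eqP tb|tb]; last by exfalso; apply: nBz; exists t.
have [t0|t0] := leP 0 t.
  right; exists (phi t z) => //; rewrite -tb ger0_norm // flowNK //.
left; exists (phi t z) => //; rewrite -tb ltr0_norm // flowNK //.
Qed.

End FlowBoxes.

Theorem theoremB (R : realType) (X : metricType R) (phi : R -> X -> X) :
  compact [set: X] ->
  ~ covering_dim_le X 1 ->
  is_flow phi -> regular_flow phi -> expansive_flow phi ->
  infinite_set [set K : set X | minimal_set phi K].
Proof.
move=> cX dim flow reg expa fin; apply: dim.
have [ps net] := finite_minimal_net cX flow fin.
have [V [c [s0 [r0 LS]]]] := section_function cX flow reg.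
apply: covering_dim_le1 => // x O oO Ox.
apply: (flow_box cX flow LS oO Ox).
exact: (section_totally_disconnected cX flow expa LS net).
Qed.
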